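(* Let $\mathcal A$ be any cluster algebra of rank $2$ and let $x,x'$ be any pair of its cluster variables. If $(x\parallel x')=(x'\parallel x)=1$, then there exists a set $X$ of cluster variables such that $X\cup\{x\}$ and $X\cup\{x'\}$ are both clusters.
   Context: A semifield $\mathbb P$ is an abelian multiplicative group with a (commutative, associative) addition $\oplus$ over which multiplication distributes. Its group ring $\mathbb{ZP}$ is a domain; $\mathcal F$ denotes the field of rational functions in $n$ variables over the fraction field of $\mathbb{ZP}$. A labeled seed of rank $n$ is a triple $(\mathbf x,\mathbf y,B)$ where $\mathbf x=(x_1,\dots,x_n)$ is a free generating set of $\mathcal F$ (a cluster; its entries are cluster variables), $\mathbf y\in\mathbb P^n$, and $B=(b_{ij})$ is an $n\times n$ integer skew-symmetrizable matrix (there is a positive integer diagonal matrix $S$ with $SB$ skew-symmetric). With $[b]_+=\max(b,0)$, the mutation $\mu_k$ sends $(\mathbf x,\mathbf y,B)$ to $(\mathbf x',\mathbf y',B')$: $b'_{ij}=-b_{ij}$ if $i=k$ or $j=k$, and $b'_{ij}=b_{ij}+[b_{ik}]_+b_{kj}+b_{ik}[-b_{kj}]_+$ otherwise; $y'_k=y_k^{-1}$ and $y'_j=y_jy_k^{[b_{kj}]_+}(y_k\oplus1)^{-b_{kj}}$ for $j\ne k$; $x'_j=x_j$ for $j\neq k$ and $x'_k=\frac{y_k\prod_i x_i^{[b_{ik}]_+}+\prod_i x_i^{[-b_{ik}]_+}}{(y_k\oplus1)x_k}$. $\mathbb T_n$ is the $n$-regular tree with edges labeled $1,\dots,n$, the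 $n$ edges at each vertex having different labels. A cluster pattern assigns to each $t\in\mathbb T_n$ a labeled seed $(\mathbf x_t,\mathbf y_t,B_t)$, $\mathbf x_t=(x_{1;t},\dots,x_{n;t})$, such that seeds at the ends of an edge labeled $k$ are related by $\mu_k$. The cluster algebra $\mathcal A(B)$ (of rank $n$) is the $\mathbb{ZP}$-subalgebra of $\mathcal F$ generated by the set $\mathcal X$ of all cluster variables, where $B=B_{t_0}$ is the exchange matrix at a fixed initial vertex $t_0$; coefficients are arbitrary. Here clusters are regarded as (unordered) sets. $F$-polynomials and compatibility degree. Take the cluster pattern with exchange matrix $B$ at $t_0$, coefficients in the tropical semifield $\mathrm{Trop}(y_1,\dots,y_n)$ (free abelian group on the $y_i$ with $\prod y_i^{a_i}\oplus\prod y_i^{b_i}=\prod y_i^{\min(a_i,b_i)}$) and $\mathbf y_{t_0}=(y_1,\dots,y_n)$. $F_{j;t}^{B;t_0}(y_1,\dots,y_n)$ is the polynomial obtained from the expression of $x_{j;t}$ in $x_1,\dots,x_n,y_1,\dots,y_n$ by setting all $x_i=1$, and $f_{ij;t}^{B;t_0}$ is the maximal degree of $y_i$ in it; these depend only on $B,t_0,t,i,j$ and are used for arbitrary coefficients. $f_{ij;t'}^{B_t;t}$ is defined in the same way with initial vertex $t$ and initial matrix $B_t$. The compatibility degree $(\cdot\parallel\cdot):\mathcal X\times\mathcal X\to\mathbb Z_{\ge0}$ is $(x\parallel x')=f_{ij;t'}^{B_t;t}$ whenever $x=x_{i;t}$, $x'=x_{j;t'}$ (this is independent of choices). *)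

(* Defs.v *)
From HB Require Import structures.
From mathcomp Require Import all_boot all_order all_algebra.
From mathcomp Require Import finmap mpoly zify.
From Stdlib Require Import ClassicalEpsilon.

Set Implicit Arguments.
Unset Strict Implicit.
Unset Printing Implicit Defensive.

Import Order.TTheory GRing.Theory Num.Theory.

Local Open Scope ring_scope.

Local Notation "p %:F" := (FracField.tofrac p) : ring_scope.

HB.mixin Record Group_isSemifield P of Group P := {
  oplus : P -> P -> P;
  semifield_mulgC : forall p q : P, (p * q = q * p)%g;
  oplusC : commutative oplus;
  oplusA : associative oplus;
  mulg_oplusr : forall p q r : P, (p * oplus q r = oplus (p * q) (p * r))%g
}.

#[short(type="semifieldType")]
HB.structure Definition Semifield := { P of Group_isSemifield P & Group P }.

Definition expgz (P : groupType) (p : P) (m : int) : P :=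
  match m with
  | Posz k => (p ^+ k)%g
  | Negz k => (p ^- k.+1)%g
  end.

Definition lincomb (P : Type) (K : fieldType) (e : P -> K)
    (s : seq P) (c : P -> int) : K :=
  \sum_(p <- s) (c p)%:~R * e p.

(* [e : P -> K] exhibits K as a field of fractions of the group ring ZP: by the
   first three clauses the additive span of the image of e is a copy of ZP, and
   by the last one every element of K is a quotient of two elements of it. This
   determines (K, e) up to a unique isomorphism. *)
Record frac_group_ring (P : semifieldType) (K : fieldType) (e : P -> K) :
    Prop := FracGroupRing {
  frac_group_ring1 : e 1%g = 1;
  frac_group_ringM : forall p q : P, e (p * q)%g = e p * e q;
  frac_group_ring_free : forall (s : seq P) (c : P -> int), uniq s ->
    lincomb e s c = 0 -> forall p, p \in s -> c p = 0;
  frac_group_ring_gen : forall z : K, exists (s : seq P) (c d : P -> int),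
    lincomb e s d != 0 /\ z = lincomb e s c / lincomb e s d
}.

Definition ratfun (K : fieldType) (n : nat) := {fraction {mpoly K[n]}}.

Definition ratfunC (K : fieldType) (n : nat) (c : K) : ratfun K n :=
  (c%:MP_[n])%:F.

Definition eval_at (K : fieldType) (n : nat) (x : 'I_n -> ratfun K n)
    (p : {mpoly K[n]}) : ratfun K n :=
  mmap (@ratfunC K n) x p.

Definition free_generating (K : fieldType) (n : nat) (x : 'I_n -> ratfun K n) :
    Prop :=
  (forall p : {mpoly K[n]}, eval_at x p = 0 -> p = 0) /\
  (forall z : ratfun K n, exists p q : {mpoly K[n]},
     eval_at x q != 0 /\ z = eval_at x p / eval_at x q).

Record seed (P : semifieldType) (K : fieldType) (n : nat) := Seed {
  seed_x : {ffun 'I_n -> ratfun K n};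
  seed_y : {ffun 'I_n -> P};
  seed_B : 'M[int]_n
}.

Definition skew_symmetrizable (n : nat) (B : 'M[int]_n) : Prop :=
  exists S : 'rV[int]_n,
    (forall i, 0 < S 0 i) /\ (diag_mx S *m B)^T = - (diag_mx S *m B).

Definition is_labeled_seed (P : semifieldType) (K : fieldType) (n : nat)
    (sd : seed P K n) : Prop :=
  free_generating (seed_x sd) /\ skew_symmetrizable (seed_B sd).

Definition pos_part (b : int) : int := Num.max b 0.

Definition mut_B (n : nat) (k : 'I_n) (B : 'M[int]_n) : 'M[int]_n :=
  \matrix_(i, j)
    if (i == k) || (j == k) then - B i j
    else B i j + pos_part (B i k) * B k j + B i k * pos_part (- B k j).

Definition mut_y (P : semifieldType) (n : nat) (k : 'I_n) (B : 'M[int]_n)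
    (y : {ffun 'I_n -> P}) : {ffun 'I_n -> P} :=
  [ffun j => if j == k then (y k)^-1%g
             else (y j * expgz (y k) (pos_part (B k j))
                       * expgz (oplus (y k) 1) (- B k j))%g].

Definition mut_x (P : semifieldType) (K : fieldType) (e : P -> K) (n : nat)
    (k : 'I_n) (sd : seed P K n) : {ffun 'I_n -> ratfun K n} :=
  let x := seed_x sd in let y := seed_y sd in let B := seed_B sd in
  [ffun j =>
     if j == k then
       (ratfunC n (e (y k)) * \prod_(i < n) x i ^ pos_part (B i k)
          + \prod_(i < n) x i ^ pos_part (- B i k))
       / (ratfunC n (e (oplus (y k) 1%g)) * x k)
     else x j].

Definition mutation (P : semifieldType) (K : fieldType) (e : P -> K) (n : nat)
    (k : 'I_n) (sd : seed P K n) : seed P K n :=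
  Seed (mut_x e k sd) (mut_y k (seed_B sd) (seed_y sd)) (mut_B k (seed_B sd)).

(* The n-regular tree T_n is realized as the Cayley graph of the free product of
   n copies of Z/2: its vertices are the words in the labels without two equal
   adjacent letters, and the edge labeled k at w leads to k :: w, or to the tail
   of w if w starts with k. *)

Definition reduced (n : nat) (w : seq 'I_n) : bool :=
  sorted (fun a b : 'I_n => a != b) w.

Definition tree (n : nat) := {w : seq 'I_n | reduced w}.

Definition step_word (n : nat) (k : 'I_n) (w : seq 'I_n) : seq 'I_n :=
  if w is a :: v then (if a == k then v else k :: w) else [:: k].

Lemma step_word_reduced (n : nat) (k : 'I_n) (w : seq 'I_n) :
  reduced w -> reduced (step_word k w).
Proof.
case: w => [|a v] //= av; case: ifPn => [_|ak]; first exact: path_sorted av.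
by rewrite /reduced /= eq_sym ak.
Qed.

Definition neighbor (n : nat) (k : 'I_n) (t : tree n) : tree n :=
  exist _ (step_word k (val t)) (step_word_reduced k (valP t)).

Lemma neighborK (n : nat) (k : 'I_n) : involutive (@neighbor n k).
Proof.
move=> [w wr]; apply: val_inj => /=; case: w wr => [|a v] /=; first by rewrite eqxx.
case: (eqVneq a k) => [->|ak] /=; last by rewrite eqxx.
by case: v => //= b v /andP[]; rewrite eq_sym => /negbTE ->.
Qed.

Definition cluster_pattern (P : semifieldType) (K : fieldType) (e : P -> K)
    (n : nat) (Sigma : tree n -> seed P K n) : Prop :=
  (forall t, is_labeled_seed (Sigma t)) /\
  (forall t k, Sigma (neighbor k t) = mutation e k (Sigma t)).

Definition is_cluster_variable (P : semifieldType) (K : fieldType) (n : nat)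
    (Sigma : tree n -> seed P K n) (z : ratfun K n) : Prop :=
  exists (t : tree n) (i : 'I_n), z = seed_x (Sigma t) i.

Definition cluster (P : semifieldType) (K : fieldType) (n : nat)
    (Sigma : tree n -> seed P K n) (t : tree n) : {fset ratfun K n} :=
  [fset seed_x (Sigma t) i | i in 'I_n]%fset.

Definition is_cluster (P : semifieldType) (K : fieldType) (n : nat)
    (Sigma : tree n -> seed P K n) (C : {fset ratfun K n}) : Prop :=
  exists t : tree n, C = cluster Sigma t.

(* The tropical semifield Trop(y_1, ..., y_n): the monomial prod_i y_i ^ a_i is
   encoded by its exponent vector a. *)

Definition trop (n : nat) := {ffun 'I_n -> int}.

HB.instance Definition _ (n : nat) := Choice.on (trop n).

Section Trop.
Variable n : nat.
Implicit Types a b c : trop n.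

Definition trop_mul a b : trop n := [ffun i => a i + b i].
Definition trop_one : trop n := [ffun=> 0].
Definition trop_inv a : trop n := [ffun i => - a i].
Definition trop_oplus a b : trop n := [ffun i => Num.min (a i) (b i)].

Lemma trop_mulA : associative trop_mul.
Proof. by move=> a b c; apply/ffunP => i; rewrite !ffunE addrA. Qed.
Lemma trop_mulC : commutative trop_mul.
Proof. by move=> a b; apply/ffunP => i; rewrite !ffunE addrC. Qed.
Lemma trop_mul1 : left_id trop_one trop_mul.
Proof. by move=> a; apply/ffunP => i; rewrite !ffunE add0r. Qed.
Lemma trop_mulr1 : right_id trop_one trop_mul.
Proof. by move=> a; rewrite trop_mulC trop_mul1. Qed.
Lemma trop_mulV : left_inverse trop_one trop_inv trop_mul.
Proof. by move=> a; apply/ffunP => i; rewrite !ffunE addNr. Qed.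
Lemma trop_mulrV : right_inverse trop_one trop_inv trop_mul.
Proof. by move=> a; rewrite trop_mulC trop_mulV. Qed.

HB.instance Definition _ := isGroup.Build (trop n)
  trop_mulA trop_mul1 trop_mulr1 trop_mulV trop_mulrV.

Lemma trop_oplusC : commutative trop_oplus.
Proof. by move=> a b; apply/ffunP => i; rewrite !ffunE minC. Qed.
Lemma trop_oplusA : associative trop_oplus.
Proof. by move=> a b c; apply/ffunP => i; rewrite !ffunE minA. Qed.
Lemma trop_mul_oplusr a b c :
  (a * trop_oplus b c = trop_oplus (a * b) (a * c))%g.
Proof. by apply/ffunP => i; rewrite !ffunE addr_minr. Qed.

HB.instance Definition _ := Group_isSemifield.Build (trop n)
  trop_mulC trop_oplusC trop_oplusA trop_mul_oplusr.

End Trop.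

Definition trop_var (n : nat) (i : 'I_n) : trop n := [ffun j => (i == j)%:Z].

(* Q(y_1, ..., y_n), the field of fractions of the group ring of Trop(y). *)
Definition trop_field (n : nat) := {fraction {mpoly int[n]}}.

Definition trop_embed (n : nat) (a : trop n) : trop_field n :=
  \prod_(i < n) ('X_i : {mpoly int[n]})%:F ^ a i.

Lemma fraction_quotient (R : idomainType) (z : {fraction R}) :
  exists p q : R, q != 0 /\ z = p%:F / q%:F.
Proof.
elim/quotW: z => r; exists \n_r, \d_r; split; first exact: denom_ratioP.
have d0 : (\d_r)%:F != 0 :> {fraction R} by rewrite tofrac_eq0 denom_ratioP.
apply: (mulIf d0); rewrite mulfVK // -[r in LHS]Ratio_numden.
rewrite -[LHS]/(FracField.mul _ _) !piE; apply/eqmodP.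
by rewrite /= FracField.equivfE /FracField.mulf !numden_Ratio ?mulr1
  ?oner_eq0 ?denom_ratioP // mulrC.
Qed.

Section TropFracGroupRing.
Variable n : nat.

Let yvar (i : 'I_n) : trop_field n := ('X_i : {mpoly int[n]})%:F.

Let yvar_neq0 i : yvar i != 0.
Proof. by rewrite tofrac_eq0 -msupp_eq0 msuppX. Qed.

Let trop_embedM (a b : trop n) :
  trop_embed (a * b)%g = trop_embed a * trop_embed b.
Proof.
rewrite /trop_embed -big_split; apply: eq_bigr => i _ /=.
by rewrite -expfzDr ?yvar_neq0 // ffunE.
Qed.

Let trop_of_mnm (m : 'X_{1..n}) : trop n := [ffun i => (m i)%:Z].

Let mnm_of_trop (a : trop n) : 'X_{1..n} := [multinom `|a i|%N | i < n].

Let trop_of_mnmK : cancel trop_of_mnm mnm_of_trop.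
Proof. by move=> m; apply/mnmP => i; rewrite mnmE ffunE. Qed.

Let trop_embed_mnm (m : 'X_{1..n}) :
  trop_embed (trop_of_mnm m) = ('X_[m] : {mpoly int[n]})%:F.
Proof.
rewrite mpolyXE_id rmorph_prod; apply: eq_bigr => i _.
by rewrite ffunE -exprnP rmorphXn.
Qed.

Let lincomb_mpoly (s : seq 'X_{1..n}) (p : {mpoly int[n]}) :
  uniq s -> {subset msupp p <= s} ->
  p%:F = lincomb (@trop_embed n) (map trop_of_mnm s)
           (fun a => p@_(mnm_of_trop a)) :> trop_field n.
Proof.
move=> s_uniq ps; rewrite [p in LHS]mpolyE rmorph_sum /lincomb [in RHS]big_map /=.
rewrite [in RHS](bigID (fun m => m \in msupp p)) /= [X in _ + X]big1 ?addr0; last first.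
  by move=> m mp; rewrite trop_of_mnmK memN_msupp_eq0 // mul0r.
have ms : perm_eq (msupp p) [seq m <- s | m \in msupp p].
  apply: uniq_perm; rewrite ?msupp_uniq ?filter_uniq // => m.
  by rewrite mem_filter; case: (boolP (m \in msupp p)) => // /ps ->.
rewrite -[in RHS]big_filter (perm_big _ ms) /=.
apply: eq_bigr => m _; rewrite trop_of_mnmK trop_embed_mnm.
by rewrite -mul_mpolyC rmorphM /= -[p@_m in LHS]intz !rmorph_int.
Qed.

Lemma trop_frac_group_ring : frac_group_ring (@trop_embed n).
Proof.
split.
- by rewrite /trop_embed big1 // => i _; rewrite ffunE expr0z.
- exact: trop_embedM.
- move=> s c s_uniq s0 a a_s.
  pose N := \sum_(b <- s) \sum_(i < n) `|b i|%N.
  pose sh : trop n := [ffun=> N%:Z].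
  have shE b : b \in s -> trop_of_mnm (mnm_of_trop (b * sh)%g) = (b * sh)%g.
    move=> bs; apply/ffunP => i; rewrite !ffunE mnmE !ffunE.
    have : (`|b i| <= N)%N.
      rewrite /N (big_rem b) //= (bigD1 i) //=; exact: leq_trans (leq_addr _ _) (leq_addr _ _).
    by lia.
  have inj : {in s &, injective (fun b => mnm_of_trop (b * sh)%g)}.
    move=> b b' bs bs' /(congr1 trop_of_mnm); rewrite !shE // => /ffunP eqb.
    by apply/ffunP => i; have := eqb i; rewrite !ffunE => /addIr.
  pose p : {mpoly int[n]} := \sum_(b <- s) c b *: 'X_[mnm_of_trop (b * sh)%g].
  have p0 : p = 0.
    apply/eqP; rewrite -tofrac_eq0; apply/eqP.
    rewrite -[RHS](mul0r (trop_embed sh)) -s0 /lincomb big_distrl rmorph_sum /=.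
    apply: eq_big_seq => b bs; rewrite -mulrA -trop_embedM -(shE b bs).
    rewrite trop_embed_mnm -mul_mpolyC rmorphM /= shE //.
    by rewrite -[c b in LHS]intz !rmorph_int.
  have := congr1 (mcoeff (mnm_of_trop (a * sh)%g)) p0.
  rewrite mcoeff0 /p raddf_sum /= (big_rem a) //= big_seq big1 ?addr0.
    by rewrite mcoeffZ mcoeffX eqxx mulr1.
  move=> b; rewrite mem_rem_uniq // inE => /andP[ba bs].
  rewrite mcoeffZ mcoeffX; case: eqP => [/inj|]; last by rewrite mulr0.
  by move=> /(_ bs a_s) eba; rewrite eba eqxx in ba.
- move=> z; have [p [q [q0 ->]]] := fraction_quotient z.
  pose s := undup (msupp p ++ msupp q).
  exists (map trop_of_mnm s), (fun a => p@_(mnm_of_trop a)), (fun a => q@_(mnm_of_trop a)).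
  by rewrite -!lincomb_mpoly ?undup_uniq ?tofrac_eq0 // => m;
    rewrite mem_undup mem_cat => ->; rewrite ?orbT.
Qed.

End TropFracGroupRing.
Definition trop_initial_seed (n : nat) (B : 'M[int]_n) :
    seed (trop n) (trop_field n) n :=
  Seed [ffun i => ('X_i : {mpoly trop_field n[n]})%:F]
       [ffun i => trop_var i] B.

(* c is the value at x_1 = ... = x_n = 1 of the rational function z; it is
   computed on any representation of z whose denominator does not vanish there. *)
Definition value_at_ones (K : fieldType) (n : nat) (z : ratfun K n) (c : K) :
    Prop :=
  exists num den : {mpoly K[n]},
    [/\ z = num%:F / den%:F, den.@[fun=> 1] != 0 &
        c = num.@[fun=> 1] / den.@[fun=> 1]].

Definition is_F_polynomial (n : nat) (B : 'M[int]_n) (t0 t : tree n) (j : 'I_n)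
    (p : {mpoly int[n]}) : Prop :=
  exists Sigma : tree n -> seed (trop n) (trop_field n) n,
    [/\ cluster_pattern (@trop_embed n) Sigma,
        Sigma t0 = trop_initial_seed B &
        value_at_ones (seed_x (Sigma t) j) (p%:F : trop_field n)].

Definition F_polynomial (n : nat) (B : 'M[int]_n) (t0 t : tree n) (j : 'I_n) :
    {mpoly int[n]} :=
  epsilon (inhabits 0) (is_F_polynomial B t0 t j).

Definition deg_in (n : nat) (i : 'I_n) (p : {mpoly int[n]}) : nat :=
  \max_(m <- msupp p) m i.

Definition f_entry (n : nat) (B : 'M[int]_n) (t0 : tree n) (i j : 'I_n)
    (t : tree n) : nat :=
  deg_in i (F_polynomial B t0 t j).

(* The value does not depend on the choice of i, j, t, t'; [epsilon] returns the
   one obtained from some such choice whenever z and z' are cluster variables. *)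
Definition compat_degree (P : semifieldType) (K : fieldType) (n : nat)
    (Sigma : tree n -> seed P K n) (z z' : ratfun K n) : nat :=
  epsilon (inhabits 0%N) (fun d =>
    exists (i j : 'I_n) (t t' : tree n),
      [/\ z = seed_x (Sigma t) i, z' = seed_x (Sigma t') j &
          d = f_entry (seed_B (Sigma t)) t i j t']).

(* Main.v *)
(* In rank 2 the tree is a line, so the cluster variables form a sequence [x m] whose
   clusters are [{x m, x m.+1}], and exchangeable variables are those at distance 2.
   After normalizing the coefficients, the exchange relations read
   [x m.+2 * x m = (1 + z m * x m.+1 ^+ a m.+1) / (1 (+) z m)] and
   [z m.+2 * z m = (1 (+) z m.+1) ^+ a m.+1] with alternating exponents [a].
   - If [a 0 * a 1 <= 3] (types A1xA1, A2, B2, G2) the sequence has period 4, 5, 6, 8: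
     both [z] and [z m * x m.+1 ^+ a m.+1] satisfy the same recurrence, whose
     periodicity is a computation in a commutative semiring.
   - The degrees of the F-polynomials are given by the linear recurrence
     [chain c m.+2 = c m * chain c m.+1 - chain c m] up to the period. Hence a
     compatibility degree 1 forces the distance to be 2 up to periodicity, or to be
     odd with the exponent attached to the label of the first variable equal to 1 and
     the other exponent at least 2.
   - If the second case occurred for both [(x || x')] and [(x' || x)], then [x] would
     carry both labels; this is impossible because the degree of [x j] in [x 1] (with
     respect to the cluster [{x 0, x 1}]) is positive when [j] is odd and smaller than
     the period minus 1. *)

Require Import Defs.
From HB Require Import structures.
From mathcomp Require Import all_boot all_order all_algebra.
From mathcomp Require Import finmap mpoly zify ring.
From Stdlib Require Import ClassicalEpsilon.

Set Implicit Arguments.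
Unset Strict Implicit.
Unset Printing Implicit Defensive.

Import Order.TTheory GRing.Theory Num.Theory.

Local Open Scope ring_scope.

Local Notation "p %:F" := (FracField.tofrac p) : ring_scope.

(** * Periodicity of the coefficient recurrence *)

(* Adding a zero turns a semifield into a semiring, so that [ring] applies. *)
Section OptSemiring.
Variable P : semifieldType.

Definition semifield0 : Type := option P.
HB.instance Definition _ := Choice.on semifield0.

Implicit Types a b c : semifield0.
Definition sf0_add a b : semifield0 :=
  match a, b with Some p, Some q => Some (oplus p q) | Some p, None => Some p | None, _ => b end.
Definition sf0_mul a b : semifield0 :=
  match a, b with Some p, Some q => Some (p * q)%g | _, _ => None end.

Lemma sf0_addA : associative sf0_add.
Proof. by case=> [a|] [b|] [c|] //=; rewrite oplusA. Qed.
Lemma sf0_addC : commutative sf0_add.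
Proof. by case=> [a|] [b|] //=; rewrite oplusC. Qed.
Lemma sf0_add0 : left_id None sf0_add.
Proof. by case. Qed.
HB.instance Definition _ := GRing.isNmodule.Build semifield0 sf0_addA sf0_addC sf0_add0.

Lemma sf0_mulA : associative sf0_mul.
Proof. by case=> [a|] [b|] [c|] //=; rewrite mulgA. Qed.
Lemma sf0_mulC : commutative sf0_mul.
Proof. by case=> [a|] [b|] //=; rewrite semifield_mulgC. Qed.
Lemma sf0_mul1 : left_id (Some 1%g) sf0_mul.
Proof. by case=> [a|] //=; rewrite mul1g. Qed.
Lemma sf0_mulDl : left_distributive sf0_mul sf0_add.
Proof. by case=> [a|] [b|] [c|] //=; rewrite semifield_mulgC mulg_oplusr !(semifield_mulgC c). Qed.
Lemma sf0_mul0 : left_zero None sf0_mul.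
Proof. by case. Qed.
HB.instance Definition _ := GRing.Nmodule_isComPzSemiRing.Build semifield0
  sf0_mulA sf0_mulC sf0_mul1 sf0_mulDl sf0_mul0.
End OptSemiring.

Section Periodicity.
Variable R : comPzSemiRingType.

Lemma lreg_mul (x y : R) : GRing.lreg x -> GRing.lreg y -> GRing.lreg (x * y).
Proof. by move=> xr yr u v; rewrite -!mulrA => /xr /yr. Qed.

Lemma lreg_exp (x : R) k : GRing.lreg x -> GRing.lreg (x ^+ k).
Proof.
move=> xr; elim: k => [|k IH]; rewrite ?expr0 ?exprS; last exact: lreg_mul.
by move=> u v; rewrite !mul1r.
Qed.

(* Writes the next term as N''/D'' when the two previous ones are N/D, N'/D'. *)
Lemma exchange_quotient (z z' z'' D D' D'' N N' N'' : R) k :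
  GRing.lreg z -> GRing.lreg D -> GRing.lreg D' ->
  z'' * z = (1 + z') ^+ k -> z * D = N -> z' * D' = N' ->
  (D' + N') ^+ k * D * D'' = N'' * N * D' ^+ k -> z'' * D'' = N''.
Proof.
move=> zr Dr D'r Ez ED ED' E.
have NDr : GRing.lreg (N * D' ^+ k) by rewrite -ED; do !apply: lreg_mul => //; exact: lreg_exp.
apply: NDr; have -> : N * D' ^+ k * N'' = N'' * N * D' ^+ k by ring.
rewrite -E -ED.
have -> : z * D * D' ^+ k * (z'' * D'') = z'' * z * D' ^+ k * D * D'' by ring.
by rewrite Ez -exprMn mulrDl mul1r ED'.
Qed.

Section Sequence.
Variable z : nat -> R.
Hypothesis zr : forall m, GRing.lreg (z m).
Variable a : nat.
Hypothesis zE0 : forall m, ~~ odd m -> z m.+2 * z m = 1 + z m.+1.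
Hypothesis zE1 : forall m, odd m -> z m.+2 * z m = (1 + z m.+1) ^+ a.

Let reg1 : GRing.lreg (1 : R). Proof. by move=> u v; rewrite !mul1r. Qed.
Let z0 : z 0 * 1 = z 0. Proof. by rewrite mulr1. Qed.
Let z1 : z 1 * 1 = z 1. Proof. by rewrite mulr1. Qed.
Let step0 m := fun (o : ~~ odd m) D D' D'' N N' N'' Dr D'r =>
  @exchange_quotient (z m) (z m.+1) (z m.+2) D D' D'' N N' N'' 1 (@zr m) Dr D'r (zE0 o).
Let step1 m := fun (o : odd m) D D' D'' N N' N'' Dr D'r =>
  @exchange_quotient (z m) (z m.+1) (z m.+2) D D' D'' N N' N'' a (@zr m) Dr D'r (zE1 o).

Ltac reg := lazymatch goal with
  | |- GRing.lreg (_ * _) => refine (lreg_mul _ _); reg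
  | |- GRing.lreg (_ ^+ _) => refine (lreg_exp _); reg
  | |- GRing.lreg 1 => exact reg1
  | |- _ => exact (@zr _)
  end.

Local Notation u := (z 0).
Local Notation v := (z 1).

(** Successive terms are explicit fractions in [z 0] and [z 1], kept with cleared denominators as
    [z i * D = N] because a semiring has no division. The computation goes on until the two initial
    terms reappear. *)
Lemma period_A2 : a = 1%N -> z 5 = z 0 /\ z 6 = z 1.
Proof.
move=> a1; have st := step1; rewrite a1 in st.
have h2 : z 2 * z 0 = 1 + z 1 by exact: zE0.
have h3 : z 3 * (z 0 * z 1) = 1 + z 0 + z 1.
  by apply: (@st 1 isT _ _ _ _ _ _ _ _ z1 h2); [reg | reg | ring].
have h4 : z 4 * z 1 = 1 + z 0 by apply: (@step0 2 isT _ _ _ _ _ _ _ _ h2 h3); [reg | reg | ring].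
have h5 : z 5 * 1 = z 0 by apply: (@st 3 isT _ _ _ _ _ _ _ _ h3 h4); [reg | reg | ring].
have h6 : z 6 * 1 = z 1 by apply: (@step0 4 isT _ _ _ _ _ _ _ _ h4 h5); [reg | reg | ring].
by rewrite -h5 -h6 !mulr1.
Qed.

(** The third identity serves the cluster variables at positions of exponent 2: there the driving
    sequence determines only the square of the variable, and this relation removes the ambiguity. *)
Lemma period_B2 : a = 2%N ->
  [/\ z 6 = z 0, z 7 = z 1 & (1 + z 0) * (1 + z 4) = z 5 * (1 + z 2)].
Proof.
move=> a2; have st := step1; rewrite a2 in st.
have h2 : z 2 * z 0 = 1 + z 1 by exact: zE0.
have h3 : z 3 * (z 0 ^+ 2 * z 1) = (1 + z 0 + z 1) ^+ 2.
  by apply: (@st 1 isT _ _ _ _ _ _ _ _ z1 h2); [reg | reg | ring].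
have h4 : z 4 * (z 0 * z 1) = (1 + z 0) ^+ 2 + z 1.
  by apply: (@step0 2 isT _ _ _ _ _ _ _ _ h2 h3); [reg | reg | ring].
have h5 : z 5 * z 1 = (1 + z 0) ^+ 2.
  by apply: (@st 3 isT _ _ _ _ _ _ _ _ h3 h4); [reg | reg | ring].
have h6 : z 6 * 1 = z 0 by apply: (@step0 4 isT _ _ _ _ _ _ _ _ h4 h5); [reg | reg | ring].
have h7 : z 7 * 1 = z 1 by apply: (@st 5 isT _ _ _ _ _ _ _ _ h5 h6); [reg | reg | ring].
split; [by rewrite -h6 mulr1 | by rewrite -h7 mulr1|].
have r : GRing.lreg (z 0 * z 1) by reg.
apply: r.
have -> : z 0 * z 1 * ((1 + z 0) * (1 + z 4)) = (1 + z 0) * (z 0 * z 1 + z 4 * (z 0 * z 1)) by ring.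
have -> : z 0 * z 1 * (z 5 * (1 + z 2)) = (z 5 * z 1) * (z 0 + z 2 * z 0) by ring.
by rewrite h4 h5 h2; ring.
Qed.

Lemma period_G2 : a = 3%N ->
  [/\ z 8 = z 0, z 9 = z 1 & (1 + z 6) * (1 + z 2) = (1 + z 4) * (1 + z 0)].
Proof.
move=> a3; have st := step1; rewrite a3 in st.
have h2 : z 2 * u = 1 + v by exact: zE0.
have h3 : z 3 * (u ^+ 3 * v) = (1 + u + v) ^+ 3.
  by apply: (@st 1 isT _ _ _ _ _ _ _ _ z1 h2); [reg | reg | ring].
have h4 : z 4 * (u ^+ 2 * v) =
    (1 + v) ^+ 2 + 3 * u * (1 + v) + 3 * u ^+ 2 + u ^+ 3.
  by apply: (@step0 2 isT _ _ _ _ _ _ _ _ h2 h3); [reg | reg | ring].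
have h5 : z 5 * (u ^+ 3 * v ^+ 2) = ((1 + u) ^+ 2 + v) ^+ 3.
  by apply: (@st 3 isT _ _ _ _ _ _ _ _ h3 h4); [reg | reg | ring].
have h6 : z 6 * (u * v) = (1 + u) ^+ 3 + v.
  by apply: (@step0 4 isT _ _ _ _ _ _ _ _ h4 h5); [reg | reg | ring].
have h7 : z 7 * v = (1 + u) ^+ 3.
  by apply: (@st 5 isT _ _ _ _ _ _ _ _ h5 h6); [reg | reg | ring].
have h8 : z 8 * 1 = u by apply: (@step0 6 isT _ _ _ _ _ _ _ _ h6 h7); [reg | reg | ring].
have h9 : z 9 * 1 = v by apply: (@st 7 isT _ _ _ _ _ _ _ _ h7 h8); [reg | reg | ring].
split; [by rewrite -h8 mulr1 | by rewrite -h9 mulr1|].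
have r : GRing.lreg (u ^+ 2 * v) by reg.
apply: r.
have -> : u ^+ 2 * v * ((1 + z 6) * (1 + z 2)) = (u * v + z 6 * (u * v)) * (u + z 2 * u) by ring.
have -> : u ^+ 2 * v * ((1 + z 4) * (1 + u)) = (u ^+ 2 * v + z 4 * (u ^+ 2 * v)) * (1 + u) by ring.
by rewrite h4 h6 h2; ring.
Qed.

End Sequence.
End Periodicity.

Section PeriodicSequence.
Variables (R : comPzSemiRingType) (z : nat -> R) (a : nat -> nat).
Hypothesis zr : forall m, GRing.lreg (z m).
Hypothesis a_per : forall m, a m.+2 = a m.
Hypothesis zE : forall m, z m.+2 * z m = (1 + z m.+1) ^+ a m.+1.

Let a_odd m k : odd m = odd k -> a m = a k.
Proof.
have a2 (n : nat) (b : bool) : a (b + n.*2) = a b.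
  by elim: n => [|n IH]; rewrite ?addn0 // doubleS !addnS a_per.
by rewrite -{2}(odd_double_half m) -{2}(odd_double_half k) => ->; rewrite !a2.
Qed.

(** The explicit computation starts at an index followed by the exponent 1 and returns two
    consecutive terms. If [a m.+1] is not 1, it is applied one step later and the recurrence is
    solved backwards for [z m]. The condition on [p] makes the exponents agree after the shift. *)
Lemma periodic_back p : ~~ odd p \/ (forall m, a m = 1%N) ->
  (forall m, a m.+1 = 1%N \/ a m.+2 = 1%N) ->
  (forall m, a m.+1 = 1%N -> z (m + p) = z m /\ z (m.+1 + p) = z m.+1) ->
  forall m, z (m + p) = z m.
Proof.
move=> pa a1 zp m; have ap k : a (k + p) = a k.
  by case: pa => [pev|E]; [apply: a_odd | by rewrite !E]; rewrite oddD (negbTE pev) addbF.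
case: (a1 m) => [/zp[]//|/zp[E1 E2]].
apply: (@zr m.+2); rewrite zE -{1}E2 !addSn zE -!addSn ap; congr ((1 + _) ^+ _).
exact: E1.
Qed.

Lemma periodic_A2 : (forall m, a m = 1%N) -> forall m, z (m + 5) = z m.
Proof.
move=> a1; apply: periodic_back => [||m _]; [by right | by left |].
have [] := @period_A2 _ (fun k => z (m + k)) (fun k => @zr (m + k)) 1 _ _ erefl.
- by move=> k _; rewrite !addnS zE a1.
- by move=> k _; rewrite !addnS zE a1.
by rewrite !addnS !addSn addn0.
Qed.

Let shiftE m c : a m.+1 = 1%N -> a m = c ->
  (forall k, ~~ odd k -> z (m + k.+2) * z (m + k) = 1 + z (m + k.+1)) /\
  (forall k, odd k -> z (m + k.+2) * z (m + k) = (1 + z (m + k.+1)) ^+ c).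
Proof.
move=> a1 ac; split=> k ok; rewrite !addnS zE.
  by rewrite (@a_odd _ m.+1) ?a1 //= oddD (negbTE ok) addbF.
by rewrite (@a_odd _ m) ?ac //= oddD ok addbT negbK.
Qed.

Lemma periodic_B2_at m : a m.+1 = 1%N -> a m = 2%N ->
  [/\ z (m + 6) = z m, z (m.+1 + 6) = z m.+1 &
      (1 + z m) * (1 + z (m + 4)) = z (m + 5) * (1 + z (m + 2))].
Proof.
move=> a1 a2; have [E0 E1] := shiftE a1 a2.
have := @period_B2 _ (fun k => z (m + k)) (fun k => @zr (m + k)) 2 E0 E1 erefl.
by rewrite !addnS !addSn addn0.
Qed.

Lemma periodic_G2_at m : a m.+1 = 1%N -> a m = 3%N ->
  [/\ z (m + 8) = z m, z (m.+1 + 8) = z m.+1 &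
      (1 + z (m + 6)) * (1 + z (m + 2)) = (1 + z (m + 4)) * (1 + z m)].
Proof.
move=> a1 a3; have [E0 E1] := shiftE a1 a3.
have := @period_G2 _ (fun k => z (m + k)) (fun k => @zr (m + k)) 3 E0 E1 erefl.
by rewrite !addnS !addSn addn0.
Qed.

Let alternate c : (forall m, (a m = 1%N /\ a m.+1 = c) \/ (a m = c /\ a m.+1 = 1%N)) ->
  forall m, a m.+1 = 1%N \/ a m.+2 = 1%N.
Proof. by move=> ac m; rewrite a_per; case: (ac m) => -[? ?]; [right | left]. Qed.

Lemma periodic_B2 :
  (forall m, (a m = 1%N /\ a m.+1 = 2%N) \/ (a m = 2%N /\ a m.+1 = 1%N)) ->
  forall m, z (m + 6) = z m.
Proof.
move=> ac; apply: periodic_back => [||m a1]; [by left | exact: alternate ac |].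
by case: (ac m) => -[am am']; [move: am'; rewrite a1 | case: (periodic_B2_at a1 am)].
Qed.

Lemma periodic_G2 :
  (forall m, (a m = 1%N /\ a m.+1 = 3%N) \/ (a m = 3%N /\ a m.+1 = 1%N)) ->
  forall m, z (m + 8) = z m.
Proof.
move=> ac; apply: periodic_back => [||m a1]; [by left | exact: alternate ac |].
by case: (ac m) => -[am am']; [move: am'; rewrite a1 | case: (periodic_G2_at a1 am)].
Qed.

End PeriodicSequence.

Lemma lreg_semifield0 (P : semifieldType) (p : P) :
  GRing.lreg (Some p : semifield0 P).
Proof. by case=> [x|] [y|] // [] /mulgI ->. Qed.

Lemma semifield0_exp (P : semifieldType) (p : P) k :
  (Some p : semifield0 P) ^+ k = Some (p ^+ k)%g.
Proof. by elim: k => [|k IH]; rewrite ?expr0 // exprS IH expgS. Qed.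

(* The exchange relations along a line of seeds, with the coefficients on the
   path normalized to [z] and [a m] the absolute values of the exponents. *)
Record exchange_sequence (P : semifieldType) (F : fieldType) (e : P -> F)
  (a : nat -> nat) (z : nat -> P) (x : nat -> F) : Prop := ExchangeSequence {
  exch_per : forall m, a m.+2 = a m;
  exch_e1 : e 1%g = 1;
  exch_eM : forall p q : P, e (p * q)%g = e p * e q;
  exch_x : forall m, x m != 0;
  exch_zE : forall m, (z m.+2 * z m)%g = (oplus 1 (z m.+1) ^+ a m.+1)%g;
  exch_xE : forall m, x m.+2 * x m =
    (1 + e (z m) * x m.+1 ^+ a m.+1) / e (oplus 1%g (z m))
}.

(** * Periodicity of the cluster variables in finite type *)

Section ExchangeSequence.
Variables (P : semifieldType) (F : fieldType) (e : P -> F).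
Variables (a : nat -> nat) (z : nat -> P) (x : nat -> F).
Hypothesis H : exchange_sequence e a z x.

Let z0 m : semifield0 P := Some (z m).
Let y m : F := e (z m) * x m.+1 ^+ a m.+1.

Lemma exch_e_neq0 p : e p != 0.
Proof.
apply/eqP => ep; have := exch_eM H p p^-1%g; rewrite mulgV (exch_e1 H) ep mul0r.
exact/eqP/oner_neq0.
Qed.

Lemma exch_eX p k : e (p ^+ k)%g = e p ^+ k.
Proof. by elim: k => [|k IH]; rewrite ?(exch_e1 H) // expgS exprS (exch_eM H) IH. Qed.

Let y_neq0 m : y m != 0.
Proof. by rewrite mulf_neq0 ?exch_e_neq0 ?expf_neq0 ?(exch_x H). Qed.

Let z0r m : GRing.lreg (z0 m). Proof. exact: lreg_semifield0. Qed.
Let yr m : GRing.lreg (y m). Proof. exact/mulfI/y_neq0. Qed.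

Let z0E m : z0 m.+2 * z0 m = (1 + z0 m.+1) ^+ a m.+1.
Proof. by rewrite -[1 + _]/(Some _) semifield0_exp -(exch_zE H). Qed.

Let xE m : x m.+2 * x m = (1 + y m) / e (oplus 1%g (z m)).
Proof. exact: (exch_xE H). Qed.

(** The factor [e (z m.+2 * z m)] is a power of [e (oplus 1 (z m.+1))] and cancels the denominators
    of the exchange relation. *)
Let yE m : y m.+2 * y m = (1 + y m.+1) ^+ a m.+1.
Proof.
have -> : y m.+2 * y m = e (z m.+2 * z m)%g * (x m.+3 * x m.+1) ^+ a m.+1.
  by rewrite /y (exch_per H) (exch_eM H) exprMn; ring.
rewrite (exch_zE H) exch_eX xE -exprMn; congr (_ ^+ _).
by rewrite mulrC divfK ?exch_e_neq0.
Qed.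

Let yx m : y m / e (z m) = x m.+1 ^+ a m.+1.
Proof. by rewrite /y mulrC mulKf ?exch_e_neq0. Qed.

Let x_per p : (forall m, z0 (m + p) = z0 m) -> (forall m, y (m + p) = y m) ->
  forall m, x (m.+2 + p) * x (m + p) = x m.+2 * x m.
Proof. by move=> zp yp m; rewrite !addSn !xE yp; have [->] := zp m. Qed.

(** The products [x m.+2 * x m] are periodic. When [a m = 1], the variable [x m.+2] itself can be
    read off from [y m.+1], so dividing by it leaves [x m]. *)
Let x_per1 p m : (forall m, z0 (m + p) = z0 m) -> (forall m, y (m + p) = y m) ->
  a m = 1%N -> a (m + p) = 1%N -> x (m + p) = x m.
Proof.
move=> zp yp am amp; have xp := x_per zp yp m.
have x2 : x (m.+2 + p) = x m.+2.
  have := yx m.+1; have := yx (m.+1 + p); rewrite yp; have [->] := zp m.+1.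
  by rewrite -!addSn !addSn !(exch_per H) am amp !expr1 => -> ->.
by move: xp; rewrite x2 => /(mulfI (exch_x H _)).
Qed.

Lemma exch_periodic_A1A1 : (forall m, a m = 0%N) -> forall m, x (m + 4) = x m.
Proof.
move=> a0 m.
have E : x m.+4 * x m.+2 = x m.+2 * x m.
  rewrite !(exch_xE H) !a0 !expr0 !mulr1.
  have zz : (z m.+2 * z m = 1)%g by rewrite (exch_zE H) a0.
  (* Here [z m] is the inverse of [z m.+2]; multiplying numerator and denominator by [e (z m)] turns
     the relation at [m.+2] into the one at [m]. *)
  rewrite -(mulfK (exch_e_neq0 (z m)) (1 + e (z m.+2))).
  rewrite mulrDl mul1r -(exch_eM H) zz (exch_e1 H) -mulrA -invfM -(exch_eM H).
  by rewrite mulg_oplusr mulg1 semifield_mulgC zz oplusC addrC.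
by apply: (mulIf (exch_x H m.+2)); rewrite !addnS addn0 E mulrC.
Qed.

Lemma exch_periodic_A2 : (forall m, a m = 1%N) -> forall m, x (m + 5) = x m.
Proof.
move=> a1 m; apply: x_per1 => //.
  exact: (@periodic_A2 _ z0 a z0r (exch_per H) z0E a1).
exact: (@periodic_A2 _ y a yr (exch_per H) yE a1).
Qed.

Lemma exch_periodic_B2 :
  (forall m, (a m = 1%N /\ a m.+1 = 2%N) \/ (a m = 2%N /\ a m.+1 = 1%N)) ->
  forall m, x (m + 6) = x m.
Proof.
move=> ac m; have zp := @periodic_B2 _ z0 a z0r (exch_per H) z0E ac.
have yp := @periodic_B2 _ y a yr (exch_per H) yE ac.
case: (ac m) => -[am am']; first by apply: x_per1; rewrite // !addnS addn0 !(exch_per H).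
have [_ _ Ez] := @periodic_B2_at _ z0 a z0r (exch_per H) z0E m am' am.
have [_ _ Ey] := @periodic_B2_at _ y a yr (exch_per H) yE m am' am.
have {}Ez : e (oplus 1%g (z m)) * e (oplus 1%g (z (m + 4))) =
            e (z (m + 5)) * e (oplus 1%g (z (m + 2))).
  by rewrite -!(exch_eM H); case: Ez => ->.
have E := yx (m + 5); have X0 := xE m; have X2 := xE m.+2; have X4 := xE m.+4.
have X := exch_x H; have En := exch_e_neq0.
rewrite !addnS !addn0 !(exch_per H) am in Ez Ey E *.

(* Only the square of [x (m + 6)] is known from [y]. After multiplication by [x (m + 4) * x (m + 2)]
   both sides are products of known factors; [Ey] compares the numerators and [Ez] the
   denominators. *)
have X6 : x m.+4.+2 ^+ 2 = x m.+4.+2 * x m.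
  apply: (mulIf (X m.+4)); apply: (mulIf (X m.+2)).
  have -> : x m.+4.+2 ^+ 2 * x m.+4 * x m.+2 = x m.+4.+2 ^+ 2 * (x m.+4 * x m.+2) by ring.
  have -> : x m.+4.+2 * x m * x m.+4 * x m.+2 = (x m.+4.+2 * x m.+4) * (x m.+2 * x m) by ring.
  rewrite X4 X2 X0 -E !mulf_div; congr (_ / _); last by rewrite -Ez mulrC.
  by rewrite -Ey mulrC.
by apply: (mulfI (X m.+4.+2)); rewrite -X6 expr2.
Qed.

Lemma exch_periodic_G2 :
  (forall m, (a m = 1%N /\ a m.+1 = 3%N) \/ (a m = 3%N /\ a m.+1 = 1%N)) ->
  forall m, x (m + 8) = x m.
Proof.
move=> ac m; have zp := @periodic_G2 _ z0 a z0r (exch_per H) z0E ac.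
have yp := @periodic_G2 _ y a yr (exch_per H) yE ac.
case: (ac m) => -[am am']; first by apply: x_per1; rewrite // !addnS addn0 !(exch_per H).
have [_ _ Ez] := @periodic_G2_at _ z0 a z0r (exch_per H) z0E m am' am.
have [_ _ Ey] := @periodic_G2_at _ y a yr (exch_per H) yE m am' am.
have {}Ez : e (oplus 1%g (z (m + 6))) * e (oplus 1%g (z (m + 2))) =
            e (oplus 1%g (z (m + 4))) * e (oplus 1%g (z m)).
  by rewrite -!(exch_eM H); case: Ez => ->.
have X0 := xE m; have X2 := xE m.+2; have X4 := xE m.+4; have X6 := xE m.+4.+2.
have X := exch_x H.
rewrite !addnS !addn0 in Ez Ey *.
(* With three intermediate variables inserted, each side is a product of two exchange relations,
   matched by [Ey] in the numerators and by [Ez] in the denominators. *)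
apply: (mulIf (X m.+4.+2)); apply: (mulIf (X m.+4)); apply: (mulIf (X m.+2)).
have -> : x m.+4.+4 * x m.+4.+2 * x m.+4 * x m.+2 =
          (x m.+4.+4 * x m.+4.+2) * (x m.+4 * x m.+2) by ring.
have -> : x m * x m.+4.+2 * x m.+4 * x m.+2 =
          (x m.+4.+2 * x m.+4) * (x m.+2 * x m) by ring.
by rewrite X4 X2 X0 X6 !mulf_div Ey Ez.
Qed.

End ExchangeSequence.

(** * The 2-regular tree as a line *)

(** Each vertex is joined to the root by successive neighbors, and [neighbor k] is an involution, so
    [Q] travels both up to the root and down from it. *)
Lemma tree_ind (n : nat) (Q : tree n -> Prop) :
  (forall t k, Q t -> Q (neighbor k t)) -> forall t t', Q t -> Q t'.
Proof.
move=> QN; have root_path w (wr : reduced w) : exists t0 : tree n, val t0 = [::] /\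
    (Q t0 <-> Q (exist _ w wr)).
  elim: w wr => [|k w IH] wr; first by exists (exist _ [::] wr).
  have wr' : reduced w := path_sorted wr.
  have [t0 [t0E t0Q]] := IH wr'; exists t0; split=> //.
  have NE : neighbor k (exist _ w wr') = exist _ (k :: w) wr.
    apply: val_inj => /=; case: w wr {wr' IH t0Q} => //= j w /andP[kj _].
    by rewrite eq_sym (negbTE kj).
  rewrite t0Q; split; first by rewrite -NE; exact: QN.
  by move=> /(QN _ k); rewrite -NE neighborK.
move=> [w wr] [w' wr'] Qt.
have [t0 [E0 Q0]] := root_path w wr; have [t1 [E1 Q1]] := root_path w' wr'.
have E01 : t1 = t0 by apply: val_inj; rewrite E0 E1.
by apply/Q1; rewrite E01; apply/Q0.
Qed.

Definition lab (k : 'I_2) (m : nat) : 'I_2 := if odd m then rev_ord k else k.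

Lemma labS k m : lab k m.+1 = rev_ord (lab k m).
Proof. by rewrite /lab /=; case: (odd m) => //=; rewrite rev_ordK. Qed.

Lemma labSS k m : lab k m.+2 = lab k m.
Proof. by rewrite !labS rev_ordK. Qed.

Lemma rev_ord2_neq (k : 'I_2) : rev_ord k != k.
Proof. by case: k => [] [|[|]]. Qed.

Lemma ord2_case (k j : 'I_2) : j != k -> j = rev_ord k.
Proof. by case: k => [] [|[|[]]] // ?; case: j => [] [|[|[]]] // ? ?; apply: val_inj. Qed.

Lemma big_ord2 (R : Type) (idx : R) (op : Monoid.com_law idx) (F : 'I_2 -> R) k :
  \big[op/idx]_(i < 2) F i = op (F k) (F (rev_ord k)).
Proof.
rewrite (bigD1 k) //= (big_pred1 (rev_ord k)) // => j /=.
by case: (eqVneq j k) => [->|/ord2_case ->] /=; rewrite ?eqxx // eq_sym (negbTE (rev_ord2_neq k)).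
Qed.

Fixpoint walk (t : tree 2) (k : 'I_2) (m : nat) : tree 2 :=
  if m is m'.+1 then neighbor (lab k m') (walk t k m') else t.

(** A neighbor of a vertex on a walk either prolongs the walk or steps back along it; at the start,
    the other edge begins the walk with the other first label. *)
Lemma walk_surj (t t' : tree 2) : exists k m, t' = walk t k m.
Proof.
move: t'; suff: forall t', (exists k m, t' = walk t k m) by [].
move=> t'; apply: (@tree_ind 2 (fun s => exists k m, s = walk t k m) _ t); last by exists 0, 0%N.
move=> _ j [k [m ->]].
case: (eqVneq j (lab k m)) => [->|jm]; first by exists k, m.+1.
case: m jm => [|m] /ord2_case ->.
  by exists (rev_ord k), 1%N.
exists k, m; rewrite labS rev_ordK; exact: neighborK.
Qed.

Lemma skew2 (B : 'M[int]_2) : skew_symmetrizable B ->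
  (forall i, B i i = 0) /\
  forall i, exists s s' : int,
    [/\ 0 < s, 0 < s' & s * B i (rev_ord i) = - (s' * B (rev_ord i) i)].
Proof.
move=> [S [Spos /matrixP SB]].
have E i j : S 0 j * B j i = - (S 0 i * B i j).
  by have := SB i j; rewrite mul_diag_mx !mxE.
split=> i; first by have := E i i; have := Spos i; nia.
by exists (S 0 i), (S 0 (rev_ord i)); rewrite !Spos E.
Qed.

(** The only entry not negated by definition is the diagonal one opposite to [k]. It is 0, and its
    two correction terms cancel because the off-diagonal entries have opposite signs. *)
Lemma mut_B2 (B : 'M[int]_2) k : skew_symmetrizable B -> mut_B k B = - B.
Proof.
move=> /skew2 [B0 Bs]; apply/matrixP => i j; rewrite !mxE.
case: ifP => // /negbT; rewrite negb_or => /andP[/ord2_case -> /ord2_case ->].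
rewrite B0 oppr0 add0r; have [s [s' [sp sp' E]]] := Bs k.
move: (B k _) (B _ k) E => b b' E.
rewrite /pos_part; case: (lerP b' 0) => b'0; rewrite ?mul0r ?add0r.
  case: (lerP (- b) 0) => b0; first by rewrite mulr0.
  nia.
case: (lerP (- b) 0) => b0; first by nia.
by rewrite mulrN addrC addNr.
Qed.

Lemma expgz_nat (P : semifieldType) (p : P) (k : nat) : expgz p k = (p ^+ k)%g.
Proof. by []. Qed.

Lemma expgzN (P : semifieldType) (p : P) (k : nat) : expgz p (- k%:Z) = (p ^- k)%g.
Proof. by case: k => [|k] //=; rewrite ?expg0 invg1. Qed.

Lemma expgMC (P : semifieldType) (p q : P) k : ((p * q) ^+ k = p ^+ k * q ^+ k)%g.
Proof. by apply: expgMn; exact: semifield_mulgC. Qed.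

Lemma ratfunC1 (K : fieldType) n : ratfunC n 1 = 1 :> ratfun K n.
Proof. by rewrite /ratfunC !rmorph1. Qed.

Lemma ratfunCM (K : fieldType) n (c d : K) : ratfunC n (c * d) = ratfunC n c * ratfunC n d.
Proof. by rewrite /ratfunC !rmorphM. Qed.

Lemma ratfunCB (K : fieldType) n : zmod_morphism (@ratfunC K n).
Proof. by move=> c d; rewrite /ratfunC !rmorphB. Qed.

Lemma ratfunC_monoid (K : fieldType) n : monoid_morphism (@ratfunC K n).
Proof. by split; [exact: ratfunC1 | exact: ratfunCM]. Qed.

HB.instance Definition _ (K : fieldType) n :=
  GRing.isZmodMorphism.Build K (ratfun K n) (@ratfunC K n) (@ratfunCB K n).
HB.instance Definition _ (K : fieldType) n :=
  GRing.isMonoidMorphism.Build K (ratfun K n) (@ratfunC K n) (@ratfunC_monoid K n).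

Lemma eval_atC (K : fieldType) n (x : 'I_n -> ratfun K n) c :
  eval_at x c%:MP = ratfunC n c.
Proof. by rewrite /eval_at mmapC. Qed.

Lemma free_neq0 (K : fieldType) n (x : 'I_n -> ratfun K n) i :
  free_generating x -> x i != 0.
Proof.
case=> fx _; apply/eqP => xi.
have : eval_at x 'X_i = 0 by rewrite /eval_at mmapX mmap1U.
by move/fx/eqP; rewrite -msupp_eq0 msuppX.
Qed.

Lemma prod_ord2 (R : comNzRingType) (F : 'I_2 -> R) k :
  \prod_(i < 2) F i = F k * F (rev_ord k).
Proof. exact: (big_ord2 _ F k). Qed.

Lemma exchange_inv (F : fieldType) (c d x x' : F) : c != 0 -> d != 0 -> x != 0 ->
  (c + x') / (d * x) * x = (1 + c^-1 * x') / (d * c^-1).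
Proof. by move=> c0 d0 x0; field; rewrite c0 d0 x0. Qed.

(** * Exchange relations along a walk *)

Section Line.
Variables (P : semifieldType) (K : fieldType) (e : P -> K).
Hypotheses (e1 : e 1%g = 1) (eM : forall p q : P, e (p * q)%g = e p * e q).
Variable Sigma : tree 2 -> seed P K 2.
Hypothesis HSigma : cluster_pattern e Sigma.
Variables (t : tree 2) (k : 'I_2).

Let B := seed_B (Sigma t).
Let sgn := 0 <= B k (rev_ord k).

Definition line_a m : nat := `|B (lab k m) (lab k m.+1)|%N.

(* The sign of [B] decides whether [y] or [1/y] drives the normalized recurrence. *)
Definition line_z m : P :=
  let u := seed_y (Sigma (walk t k m)) (lab k m) in if sgn then u^-1%g else u.

Definition line_x m : ratfun K 2 := seed_x (Sigma (walk t k m)) (lab k m).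

(** The coefficient at the other label, inverted in the opposite case to [line_z]: since mutation
    inverts the coefficient at its own label, [line_w m.+1] is [line_z m]. *)
Let line_w m : P :=
  let w := seed_y (Sigma (walk t k m)) (lab k m.+1) in if sgn then w else w^-1%g.

Let line_skew s : skew_symmetrizable (seed_B (Sigma s)).
Proof. by case: HSigma => /(_ s)[]. Qed.

Let lineS m : Sigma (walk t k m.+1) = mutation e (lab k m) (Sigma (walk t k m)).
Proof. by case: HSigma => _; exact. Qed.

Lemma lineB m : seed_B (Sigma (walk t k m)) = if odd m then - B else B.
Proof.
elim: m => [|m IH] //; rewrite lineS /= mut_B2 // IH.
by case: (odd m); rewrite ?opprK.
Qed.

Let aS m : line_a m.+2 = line_a m.
Proof. by rewrite /line_a !labSS. Qed.

Let Bz m i : seed_B (Sigma (walk t k m)) i i = 0.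
Proof. by have [-> _] := skew2 (line_skew (walk t k m)). Qed.

Let Bsgn : exists s s' : int,
  [/\ 0 < s, 0 < s' & s * B k (rev_ord k) = - (s' * B (rev_ord k) k)].
Proof. by have [_] := skew2 (line_skew t). Qed.

(** Each step negates the matrix and also exchanges the roles of the two labels, so the sign of this
    entry is constant along the walk. *)
Let Bf m : seed_B (Sigma (walk t k m)) (lab k m) (lab k m.+1) =
  if sgn then (line_a m)%:Z else - (line_a m)%:Z.
Proof.
have [s [s' [sp sp' E]]] := Bsgn.
rewrite lineB /line_a labS /sgn /lab.
by case: (odd m); rewrite ?mxE ?rev_ordK; move: (B k _) (B _ k) E => b b' E;
  case: (lerP 0 b); nia.
Qed.

Let Bb m : seed_B (Sigma (walk t k m)) (lab k m.+1) (lab k m) =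
  if sgn then - (line_a m.+1)%:Z else (line_a m.+1)%:Z.
Proof.
have [s [s' [sp sp' E]]] := Bsgn.
rewrite lineB /line_a labSS labS /sgn /lab.
by case: (odd m); rewrite ?mxE ?rev_ordK; move: (B k _) (B _ k) E => b b' E;
  case: (lerP 0 b); nia.
Qed.

Let wS m : line_w m.+1 = line_z m.
Proof.
rewrite /line_w /line_z lineS /= ffunE labSS eqxx.
by case: (boolP sgn) => _; rewrite ?invgK.
Qed.

Lemma pos_part_nat (n : nat) : pos_part n%:Z = n.
Proof. by rewrite /pos_part max_l. Qed.

Lemma pos_part_opp (n : nat) : pos_part (- n%:Z) = 0.
Proof. by rewrite /pos_part max_r // oppr_le0. Qed.

Lemma oplus_inv1 (p : P) : oplus 1%g p^-1%g = (oplus p 1 * p^-1)%g.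
Proof. by rewrite semifield_mulgC mulg_oplusr mulVg mulg1. Qed.

Let zw m : (line_z m.+1 * line_w m = oplus 1 (line_z m) ^+ line_a m)%g.
Proof.
rewrite /line_z /line_w lineS /= ffunE labS (negbTE (rev_ord2_neq _)) -labS Bf.
set u := seed_y _ _; set w := seed_y _ _; set a := line_a m.
case: (boolP sgn) => _.
  rewrite pos_part_nat expgz_nat expgzN oplus_inv1 expgMC expVgn.
  rewrite !invgM invgK [RHS](semifield_mulgC) -!mulgA mulVg mulg1.
  by rewrite semifield_mulgC.
rewrite pos_part_opp opprK expgz_nat /= expg0 mulg1 semifield_mulgC mulgA mulVg mul1g.
by rewrite oplusC.
Qed.

Lemma line_zE m : (line_z m.+2 * line_z m = oplus 1 (line_z m.+1) ^+ line_a m.+1)%g.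
Proof. by rewrite -[in LHS](wS m) zw. Qed.

Lemma line_z0 : line_z 0 = if sgn then (seed_y (Sigma t) k)^-1%g else seed_y (Sigma t) k.
Proof. by []. Qed.

Lemma line_z1 : (line_z 1 *
    (if sgn then seed_y (Sigma t) (rev_ord k) else (seed_y (Sigma t) (rev_ord k))^-1)
  = oplus 1 (line_z 0) ^+ line_a 0)%g.
Proof. exact: zw. Qed.

Lemma line_xS m : seed_x (Sigma (walk t k m)) (lab k m.+1) = line_x m.+1.
Proof.
by rewrite /line_x lineS /= ffunE labS (negbTE (rev_ord2_neq _)).
Qed.

Lemma line_x_neq0 m : line_x m != 0.
Proof. by apply: free_neq0; case: HSigma => /(_ (walk t k m))[]. Qed.

Let e_neq0 p : ratfunC 2 (e p) != 0.
Proof.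
apply/eqP => ep; have := ratfunCM 2 (e p) (e p^-1%g).
rewrite -eM mulgV e1 ratfunC1 ep mul0r; exact/eqP/oner_neq0.
Qed.

Let ratfunCe p q : ratfunC 2 (e (p * q)%g) = ratfunC 2 (e p) * ratfunC 2 (e q).
Proof. by rewrite eM ratfunCM. Qed.

Let ratfunC_inv p : ratfunC 2 (e p^-1%g) = (ratfunC 2 (e p))^-1.
Proof.
by apply: (mulfI (e_neq0 p)); rewrite -ratfunCe mulgV e1 ratfunC1 mulfV.
Qed.

Lemma line_xE m : line_x m.+2 * line_x m =
  (1 + ratfunC 2 (e (line_z m)) * line_x m.+1 ^+ line_a m.+1)
  / ratfunC 2 (e (oplus 1%g (line_z m))).
Proof.
rewrite -(line_xS m.+1) lineS /= ffunE labSS eqxx.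
rewrite !(prod_ord2 _ (lab k m)) -labS Bz oppr0 Bb line_xS -/(line_x m).
rewrite {1 3}/pos_part maxxx expr0z !mul1r.
rewrite /line_z; set u := seed_y _ _; set a := line_a m.+1.
case: (boolP sgn) => _.
  rewrite opprK pos_part_nat pos_part_opp expr0z -exprnP mulr1 oplus_inv1.
  by rewrite ratfunCe !ratfunC_inv exchange_inv ?line_x_neq0.
rewrite pos_part_nat pos_part_opp expr0z -exprnP (oplusC 1%g) addrC.
by rewrite invfM mulrA mulfVK ?line_x_neq0.
Qed.

Lemma line_exchange :
  exchange_sequence (fun p => ratfunC 2 (e p)) line_a line_z line_x.
Proof.
split; [exact: aS | by rewrite e1 ratfunC1 | by move=> p q; rewrite eM ratfunCM
  | exact: line_x_neq0 | exact: line_zE | exact: line_xE].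
Qed.

End Line.

(** * Degrees of multivariate polynomials *)

Section TopDegree.
Variables (n : nat) (R : idomainType) (w : 'X_{1..n} -> int).
Hypothesis wD : forall m1 m2, w (m1 + m2)%MM = w m1 + w m2.
Implicit Types p q : {mpoly R[n]}.

(** The additive weight [w] is kept general: below it is the degree in one variable, the negative of
    that degree (to measure the lowest order), or zero (to express nonvanishing). *)
Definition has_top p (d : int) : Prop :=
  (exists2 m, m \in msupp p & w m = d) /\ forall m, m \in msupp p -> w m <= d.

Lemma has_top_uniq p d d' : has_top p d -> has_top p d' -> d = d'.
Proof.
by move=> [[m mp <-] le] [[m' mp' <-] le']; apply/eqP; rewrite eq_le le // le'.
Qed.

Lemma has_top_neq0 p d : has_top p d -> p != 0.
Proof. by move=> [[m mp _] _]; rewrite -msupp_eq0; case: (msupp p) mp. Qed.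

Lemma has_top_ex p : p != 0 -> exists d, has_top p d.
Proof.
have seq_max (s : seq 'X_{1..n}) : s != [::] ->
    exists2 m, m \in s & forall m', m' \in s -> w m' <= w m.
  elim: s => // m s IH _; case: (eqVneq s [::]) => [->|/IH [m0 m0s m0max]].
    by exists m; rewrite ?inE // => m'; rewrite inE => /eqP ->.
  case: (lerP (w m) (w m0)) => le.
    exists m0; first by rewrite inE m0s orbT.
    by move=> m'; rewrite inE => /orP[/eqP ->|/m0max].
  exists m; first by rewrite inE eqxx.
  move=> m'; rewrite inE => /orP[/eqP ->|/m0max le'] //.
  exact: le_trans le' (ltW le).
rewrite -msupp_eq0 => /seq_max [m mp mmax]; exists (w m); split=> //; by exists m.
Qed.

Let top p d : {mpoly R[n]} := \sum_(m <- msupp p | w m == d) p@_m *: 'X_[m].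

Let mcoeff_top p d m : (top p d)@_m = if w m == d then p@_m else 0.
Proof.

rewrite /top raddf_sum /= big_mkcond /=.
rewrite (eq_bigr (fun m' => if w m == d then (p@_m' *: 'X_[m'])@_m else 0)).
  by case: ifP => _; [rewrite [p in RHS]mpolyE raddf_sum | rewrite big1].
move=> m' _; rewrite mcoeffZ mcoeffX; case: (eqVneq m' m) => [->//|_].
by rewrite mulr0 !if_same.
Qed.

(** Over a domain the product of the two top components is nonzero, and all other contributions to
    [p * q] have strictly smaller weight. *)
Lemma has_topM p q d e : has_top p d -> has_top q e -> has_top (p * q) (d + e).
Proof.
move=> [[m1 mp1 wm1] lep] [[m2 mq2 wm2] leq]; split; last first.
  move=> m /msuppM_le /allpairsP [[k1 k2] /= [kp kq ->]].
  by rewrite wD lerD ?lep ?leq.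
have top_supp r c m : m \in msupp (top r c) -> w m = c /\ m \in msupp r.
  by rewrite !mcoeff_msupp mcoeff_top; case: (eqVneq (w m) c) => [-> ?|_]; [split | rewrite eqxx].
have low_supp r c m : (forall m', m' \in msupp r -> w m' <= c) ->
    m \in msupp (r - top r c) -> w m < c.
  move=> ler; rewrite mcoeff_msupp mcoeffB mcoeff_top lt_neqAle.
  case: (eqVneq (w m) c) => [_|_]; first by rewrite subrr eqxx.
  by rewrite subr0 -mcoeff_msupp => /ler ->.
have top_neq0 r c m : m \in msupp r -> w m = c -> top r c != 0.
  move=> mr mc; apply/eqP => /(congr1 (mcoeff m)); rewrite mcoeff_top mc eqxx mcoeff0.
  by apply/eqP; rewrite -mcoeff_msupp.
have T0 : top p d * top q e != 0.
  by rewrite mulf_neq0 ?(top_neq0 _ _ _ mp1) ?(top_neq0 _ _ _ mq2).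
(* Any monomial of the product of the top components would serve; the leading one is taken as a
   specific choice. *)
have /msuppM_le/allpairsP [[k1 k2] /= [/top_supp [wk1 _] /top_supp [wk2 _] Ek]] :=
  mlead_supp T0.
exists (mlead (top p d * top q e)); last by rewrite Ek wD wk1 wk2.
set m := mlead _ in Ek *; have wm : w m = d + e by rewrite Ek wD wk1 wk2.
have -> : p * q = top p d * top q e + (top p d * (q - top q e) + (p - top p d) * q) by ring.
rewrite mcoeff_msupp mcoeffD [X in _ + X]memN_msupp_eq0 ?addr0 -?mcoeff_msupp ?mlead_supp //.
apply/negP => /msuppD_le; rewrite mem_cat => /orP[] /msuppM_le/allpairsP [[j1 j2] /=].
  case=> /top_supp [j1d _] /(low_supp _ _ _ leq) j2e Ej.
  by move: wm; rewrite Ej wD j1d; lia.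
case=> /(low_supp _ _ _ lep) j1d /leq j2e Ej.
by move: wm; rewrite Ej wD; lia.
Qed.

Lemma has_topD_lt p q d e : has_top p d -> has_top q e -> e < d -> has_top (p + q) d.
Proof.
move=> [[m mp wm] lep] [_ leq] ed; split.
  exists m => //; rewrite mcoeff_msupp mcoeffD [X in _ + X]memN_msupp_eq0 ?addr0 -?mcoeff_msupp //.
  by apply/negP => /leq; rewrite wm leNgt ed.
move=> m' /msuppD_le; rewrite mem_cat => /orP[/lep//|/leq le].
exact: le_trans le (ltW ed).
Qed.

Lemma has_topC c : c != 0 -> has_top c%:MP 0.
Proof.
move=> c0; have w0 : w 0%MM = 0 by have := wD 0%MM 0%MM; rewrite addm0; lia.
rewrite /has_top msuppC (negbTE c0).
by split=> [|m]; [exists 0%MM|]; rewrite ?inE // => /eqP ->; rewrite w0.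
Qed.

Lemma has_top_mon m : has_top 'X_[m] (w m).
Proof. by rewrite /has_top msuppX; split=> [|m']; [exists m|]; rewrite ?inE // => /eqP ->. Qed.

End TopDegree.

Lemma mpolyX_dvd (n : nat) (R : idomainType) (A : {mpoly R[n]}) (k : 'X_{1..n}) :
  (forall m, m \in msupp A -> (k <= m)%MM) -> exists C, A = 'X_[k] * C.
Proof.
move=> Ak; exists (\sum_(m <- msupp A) A@_m *: 'X_[m - k]).
rewrite mulr_sumr [A in LHS]mpolyE; apply: eq_big_seq => m /Ak km.
by rewrite -scalerAr -mpolyXD addmC submK.
Qed.

(** A nonzero constant term gives [f] order 0 in every variable, so [A] has at least the order of
    the monomial in each of them. Orders are read as tops for the negated degree. *)
Lemma mpolyX_Gauss (n : nat) (R : idomainType) (f A B : {mpoly R[n]}) (k : 'X_{1..n}) :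
  f@_0%MM != 0 -> f * A = 'X_[k] * B -> exists C, A = 'X_[k] * C.
Proof.
move=> f0 E; apply: mpolyX_dvd => m mA; apply/mnm_lepP => i.
pose w (m : 'X_{1..n}) : int := - (m i)%:Z.
have wD m1 m2 : w (m1 + m2)%MM = w m1 + w m2 by rewrite /w mnmDE PoszD opprD.
have fw : has_top w f 0.
  split=> [|m' _]; last by rewrite /w oppr_le0.
  by exists 0%MM; rewrite ?mcoeff_msupp // /w mnm0E.
have A0 : A != 0 by rewrite -msupp_eq0; case: (msupp A) mA.
have B0 : B != 0.
  by apply: contraNneq A0 => B0; move/eqP: E; rewrite B0 mulr0 mulf_eq0 (negbTE (has_top_neq0 fw)).
have [d Ad] := has_top_ex w A0; have [d' Bd'] := has_top_ex w B0.
have := has_topM wD fw Ad; rewrite E => /(has_top_uniq (has_topM wD (has_top_mon _ w k) Bd')).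
have [_ /(_ _ mA)] := Ad; have [[m' _ <-] _] := Bd'; rewrite /w.
lia.
Qed.

Section NonnegCoeffs.
Variable n : nat.
Implicit Types p q : {mpoly int[n]}.

Definition coef_nonneg p := forall m, 0 <= p@_m.

Lemma coef_nonnegM p q : coef_nonneg p -> coef_nonneg q -> coef_nonneg (p * q).
Proof.
by move=> p0 q0 m; rewrite mcoeffM; apply: sumr_ge0 => k _; rewrite mulr_ge0.
Qed.

Lemma coef_nonnegD p q : coef_nonneg p -> coef_nonneg q -> coef_nonneg (p + q).
Proof. by move=> p0 q0 m; rewrite mcoeffD addr_ge0. Qed.

Lemma coef_nonneg1 : coef_nonneg 1.
Proof. by move=> m; rewrite mcoeff1; case: (_ == _). Qed.

Lemma coef_nonneg_mon k : coef_nonneg 'X_[k].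
Proof. by move=> m; rewrite mcoeffX; case: (_ == _). Qed.

(** Nonnegative coefficients cannot cancel, so the support of the sum contains both supports. *)
Lemma has_topD_nonneg w p q d e : coef_nonneg p -> coef_nonneg q ->
  has_top w p d -> has_top w q e -> has_top w (p + q) (Num.max d e).
Proof.
move=> p0 q0 [[m mp wm] lep] [[m' mq wm'] leq]; split; last first.
  by move=> k /msuppD_le; rewrite mem_cat le_max => /orP[/lep|/leq] ->; rewrite ?orbT.
have in_l k : k \in msupp p -> k \in msupp (p + q).
  rewrite !mcoeff_msupp mcoeffD => kp; rewrite paddr_eq0 ?p0 ?q0 // negb_and kp //.
have in_r k : k \in msupp q -> k \in msupp (p + q).
  rewrite !mcoeff_msupp mcoeffD => kq; rewrite paddr_eq0 ?p0 ?q0 // negb_and kq orbT //.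
by case: (leP d e) => _; [exists m' | exists m]; auto.
Qed.

Lemma has_top_deg_in i p d : has_top (fun m => (m i)%:Z) p d -> (deg_in i p)%:Z = d.
Proof.
move=> [[m mp <-] le]; congr (Posz _); apply/eqP; rewrite eqn_leq /deg_in.
apply/andP; split; last by apply: (@leq_bigmax_seq _ (msupp p) predT (fun m : 'X_{1..n} => m i) m).
by apply/bigmax_leqP_seq => m' m'p _; have := le _ m'p; rewrite lez_nat.
Qed.

End NonnegCoeffs.

(** * Mutation of labeled seeds of rank 2 *)

Lemma exchange_monomial (R : comNzRingType) (c u v : R) (m N : nat) : (m <= N)%N ->
  c * (u * v) ^+ m * u ^+ (N - m) = u ^+ N * (v ^+ m * c).
Proof. by move=> mN; rewrite -[in RHS](subnK mN) exprD exprMn; ring. Qed.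

Lemma exchange_fraction (F : fieldType) (c u v : F) (N N' : nat) :
  c != 0 -> v != 0 -> c ^+ N' * v * c ^+ N != 0 /\
    u / v = (c ^+ N * u * c ^+ N') / (c ^+ N' * v * c ^+ N).
Proof.
move=> c0 v0; have cN i : c ^+ i != 0 by rewrite expf_neq0.
split; first by rewrite !mulf_neq0.
by apply/eqP; rewrite eqr_div ?mulf_neq0 //; apply/eqP; ring.
Qed.

(** * Exchanging one element of a free generating set *)

Section EvalAt.
Variables (K : fieldType) (n : nat).
Implicit Types (x h : 'I_n -> ratfun K n) (p q : {mpoly K[n]}).

Lemma eval_atD x p q : eval_at x (p + q) = eval_at x p + eval_at x q.
Proof. exact: rmorphD. Qed.
Lemma eval_atM x p q : eval_at x (p * q) = eval_at x p * eval_at x q.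
Proof. exact: rmorphM. Qed.
Lemma eval_atX x p k : eval_at x (p ^+ k) = eval_at x p ^+ k.
Proof. exact: rmorphXn. Qed.
Lemma eval_at_var x i : eval_at x 'X_i = x i.
Proof. by rewrite /eval_at mmapX mmap1U. Qed.
Fact eval_at_zmod x : zmod_morphism (eval_at x).
Proof. exact: rmorphB. Qed.
Fact eval_at_monoid x : monoid_morphism (eval_at x).
Proof. by split; [exact: rmorph1 | exact: rmorphM]. Qed.
HB.instance Definition _ x := GRing.isZmodMorphism.Build _ _ _ (eval_at_zmod x).
HB.instance Definition _ x := GRing.isMonoidMorphism.Build _ _ _ (eval_at_monoid x).

Lemma eval_atE x p :
  eval_at x p = \sum_(m <- msupp p) ratfunC n p@_m * \prod_i x i ^+ m i.
Proof. by []. Qed.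

Section Exchange.
Variables (k : 'I_n) (M : {mpoly K[n]}).

(* Clears the denominators after the substitution of M / 'X_k for 'X_k. *)
Definition clear_exchange N p : {mpoly K[n]} :=
  \sum_(m <- msupp p)
    (p@_m)%:MP * ((\prod_(i | i != k) 'X_i ^+ m i) * M ^+ m k * 'X_k ^+ (N - m k)).

Lemma eval_clear_exchange N p h h' :
  (forall i, i != k -> h i = h' i) -> h k * h' k = eval_at h M ->
  (forall m, m \in msupp p -> m k <= N)%N ->
  eval_at h (clear_exchange N p) = h k ^+ N * eval_at h' p.
Proof.
move=> hh' hM leN; rewrite [in RHS]eval_atE mulr_sumr /clear_exchange.
rewrite rmorph_sum; apply: eq_big_seq => m /leN mN.
rewrite /= !eval_atM eval_atC !eval_atX eval_at_var -hM.
rewrite [RHS]mulrCA; congr (_ * _); rewrite [in RHS](bigD1 k) //= rmorph_prod.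
rewrite (eq_bigr (fun i => h' i ^+ m i)); last first.
  by move=> i ik; rewrite rmorphXn /= eval_at_var hh'.
exact: exchange_monomial.
Qed.

(** The polynomial [M] has the same value at [x] and [x'], so the substitution of [M / x k] is its
    own inverse: up to a power of the exchanged variable, polynomials in one family are polynomials
    in the other. *)
Lemma free_generating_exchange (x x' : 'I_n -> ratfun K n) :
  free_generating x -> (forall i, i != k -> x' i = x i) ->
  x k * x' k = eval_at x M -> eval_at x' M = eval_at x M -> eval_at x M != 0 ->
  free_generating x'.
Proof.
move=> fx x'x xx' M' M0.
have bound p : exists N, forall m, m \in msupp p -> (m k <= N)%N.
  exists (\max_(m <- msupp p) m k)%N => m mp.
  by apply: (@leq_bigmax_seq _ _ predT (fun m : 'X_{1..n} => m k)).
have [xk0 x'k0] : x k != 0 /\ x' k != 0 by apply/andP; rewrite -negb_or -mulf_eq0 xx'.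
have x'M : x' k * x k = eval_at x' M by rewrite M' -xx' mulrC.
have xx'i i : i != k -> x i = x' i by move=> /x'x ->.
have [fx1 gx] := fx; split.
  move=> p p0; apply: (fx1); have [N leN] := bound p.
  (* The cleared polynomial vanishes at [x], hence is zero; evaluating it at [x'] instead then gives
     that [p] vanishes at [x]. *)
  have c0 : clear_exchange N p = 0.
    by apply: (fx1); rewrite (eval_clear_exchange xx'i xx' leN) p0 mulr0.
  have := eval_clear_exchange x'x x'M leN; rewrite c0.
  rewrite rmorph0.
  by move/esym/eqP; rewrite mulf_eq0 expf_eq0 (negbTE x'k0) andbF => /eqP.
move=> z; have [p [q [q0 ->]]] := gx z.
have [N leN] := bound p; have [N' leN'] := bound q.
exists (clear_exchange N p * 'X_k ^+ N'), (clear_exchange N' q * 'X_k ^+ N).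
rewrite !eval_atM !eval_atX !eval_at_var.
rewrite (eval_clear_exchange x'x x'M leN) (eval_clear_exchange x'x x'M leN').
by case: (exchange_fraction (eval_at x p) N N' x'k0 q0).
Qed.

End Exchange.
End EvalAt.

(** For [p] different from 1 this is linear independence of two group elements; for [p = 1] it says
    that 2 is nonzero in [K], again by freeness. *)
Lemma frac_group_ring_addr1 (P : semifieldType) (K : fieldType) (e : P -> K) p :
  frac_group_ring e -> e p + 1 != 0.
Proof.
case=> e1 _ efree _; apply/eqP => ep.
case: (eqVneq p 1%g) => [p1|p1].
  have := efree [:: 1%g] (fun=> 2) isT; rewrite /lincomb big_seq1 e1 mulr1.
  have -> : (2 : int)%:~R = 0 :> K by rewrite -ep p1 e1.
  by move=> /(_ erefl 1%g); rewrite inE eqxx => /(_ isT).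
have := efree [:: p; 1%g] (fun=> 1); rewrite /lincomb big_cons big_seq1 /= inE p1.
by rewrite e1 !mul1r ep => /(_ isT erefl p); rewrite inE eqxx => /(_ isT).
Qed.

Lemma mulr_divr_cancel (F : fieldType) (x u : F) : x != 0 -> x * (u / x) = u.
Proof. by move=> x0; rewrite mulrC divfK. Qed.

Lemma divr_divr_cancel (F : fieldType) (x u : F) : u != 0 -> u / (u / x) = x.
Proof. by move=> u0; rewrite invf_div mulr_divr_cancel. Qed.

Lemma exchange_split (F : fieldType) (a s u v x : F) :
  (a * u + v) / (s * x) = (a / s * u + s^-1 * v) / x.
Proof. by rewrite invfM mulrA; congr (_ / _); rewrite mulrDl mulrAC [v / s]mulrC. Qed.

Lemma expgz0 (P : semifieldType) (p : P) : expgz p 0 = 1%g.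
Proof. exact: expg0. Qed.

(** With [s = oplus u 1], the factor [u^-1 * s] is [oplus u^-1 1], so this is the return of the
    other coefficient after mutating twice. *)
Lemma expgz_mutationK (P : semifieldType) (u v s : P) (b : int) :
  (v * expgz u (pos_part b) * expgz s (- b) * expgz u^-1 (pos_part (- b))
     * expgz (u^-1 * s) b)%g = v.
Proof.
case: (intP b) => [|n|n].
- by rewrite oppr0 /pos_part maxxx !expgz0 !mulg1.
- rewrite pos_part_nat pos_part_opp expgzN expgz0 !expgz_nat expgMC expVgn mulg1.
  by rewrite (semifield_mulgC (u ^- _)%g) mulgA mulgVK mulgK.
- rewrite opprK pos_part_nat pos_part_opp expgzN expgz0 !expgz_nat expgMC !expVgn mulg1.
  by rewrite invgM invgK (semifield_mulgC (s ^- _)%g) mulgA mulgVK mulgK.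
Qed.

Section MutationRank2.
Variables (P : semifieldType) (K : fieldType) (e : P -> K).
Hypothesis He : frac_group_ring e.
Implicit Types (sd : seed P K 2) (k : 'I_2).

Let ec (p : P) : ratfun K 2 := ratfunC 2 (e p).
Let ecM p q : ec (p * q)%g = ec p * ec q.
Proof. by rewrite /ec (frac_group_ringM He) ratfunCM. Qed.
Let ec1 : ec 1%g = 1. Proof. by rewrite /ec (frac_group_ring1 He) ratfunC1. Qed.
Let e_neq0 p : e p != 0.
Proof.
apply/eqP => ep; have := frac_group_ringM He p p^-1%g.
rewrite mulgV (frac_group_ring1 He) ep mul0r; exact/eqP/oner_neq0.
Qed.
(** Since the diagonal of the matrix vanishes, the exchange numerator involves only the variable
    that is kept, so it has the same value before and after the mutation. *)
Let exch_poly k sd : {mpoly K[2]} :=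
  let y := seed_y sd k in
  let b := seed_B sd (rev_ord k) k in
  (e y / e (oplus y 1%g))%:MP * 'X_(rev_ord k) ^+ `|pos_part b|%N
  + (e (oplus y 1%g))^-1%:MP * 'X_(rev_ord k) ^+ `|pos_part (- b)|%N.

Let pos_partE (b : int) (F : fieldType) (x : F) : x ^ pos_part b = x ^+ `|pos_part b|%N.
Proof. by rewrite exprnP; congr (x ^ _); rewrite /pos_part; case: (lerP b 0); lia. Qed.

Let mut_xE k sd : skew_symmetrizable (seed_B sd) ->
  mut_x e k sd k = eval_at (seed_x sd) (exch_poly k sd) / seed_x sd k.
Proof.
move=> /skew2 [B0 _]; rewrite ffunE eqxx !(prod_ord2 _ k) B0 oppr0.
rewrite {1 3}/pos_part maxxx expr0z !mul1r !pos_partE.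
rewrite eval_atD !eval_atM !eval_atC !eval_atX eval_at_var ratfunCM.
rewrite fmorphV /=.
rewrite -/(ec _) -/(ec _).
exact: exchange_split.
Qed.

Let exch_poly_neq0 k sd : exch_poly k sd != 0.
Proof.
(* At all ones the value is [(e y + 1) / e (oplus y 1)], which is nonzero. *)
apply/eqP => /(congr1 (meval (fun=> 1))).
rewrite meval0 mevalD !mevalM !mevalC !rmorphXn /= !mevalXU !expr1n !mulr1.
rewrite -[X in _ + X]mul1r -mulrDl; apply/eqP; rewrite mulf_neq0 ?invr_eq0 ?e_neq0 //.
exact: frac_group_ring_addr1.
Qed.

Let eval_exch_poly k sd (h h' : 'I_2 -> ratfun K 2) : h (rev_ord k) = h' (rev_ord k) ->
  eval_at h (exch_poly k sd) = eval_at h' (exch_poly k sd).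
Proof.
by move=> hh'; rewrite !eval_atD !eval_atM !eval_atC !eval_atX !eval_at_var hh'.
Qed.

Let mut_x_other k sd i : i != k -> mut_x e k sd i = seed_x sd i.
Proof. by move=> ik; rewrite ffunE (negbTE ik). Qed.

Lemma mutation_labeled_seed k sd :
  is_labeled_seed sd -> is_labeled_seed (mutation e k sd).
Proof.
move=> [fx skewB]; split; last first.
  rewrite /= mut_B2 //; have [S [Spos SB]] := skewB; exists S; split=> //.
  by rewrite mulmxN linearN /= SB.
have M0 : eval_at (seed_x sd) (exch_poly k sd) != 0.
  apply/eqP => /(proj1 fx) /eqP; apply/negP; exact: exch_poly_neq0.
apply: (@free_generating_exchange _ _ k (exch_poly k sd) (seed_x sd)) => //.
- exact: mut_x_other.
- by rewrite mut_xE //; exact: mulr_divr_cancel (free_neq0 k fx).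
- by apply: eval_exch_poly; rewrite mut_x_other // rev_ord2_neq.
Qed.

Let oplus_invr (p : P) : oplus p^-1%g 1%g = (p^-1 * oplus p 1)%g.
Proof. by rewrite mulg_oplusr mulVg mulg1 oplusC. Qed.

(** Inverting the coefficient and negating the matrix swap the two terms. Mutating twice therefore
    divides the same numerator by its quotient and returns the original variable. *)
Let exch_poly_mutation k sd : skew_symmetrizable (seed_B sd) ->
  exch_poly k (mutation e k sd) = exch_poly k sd.
Proof.
move=> sB; rewrite /exch_poly /= ffunE eqxx mut_B2 // mxE opprK oplus_invr.
have eV p : e p^-1%g = (e p)^-1.
  by apply: (mulfI (e_neq0 p)); rewrite -(frac_group_ringM He) mulgV (frac_group_ring1 He) mulfV.
rewrite (frac_group_ringM He) eV invfM invrK addrC.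
congr (_%:MP * _ + _%:MP * _).
by rewrite mulrA mulVf ?mul1r.
Qed.

Lemma mutation_involutive k sd :
  is_labeled_seed sd -> mutation e k (mutation e k sd) = sd.
Proof.
move=> lsd; have [fx sB] := lsd.
have [_ sB'] := mutation_labeled_seed k lsd.
have M0 : eval_at (seed_x sd) (exch_poly k sd) != 0.
  apply/eqP => /(proj1 fx) /eqP; apply/negP; exact: exch_poly_neq0.
case: sd lsd fx sB sB' M0 => x y B lsd fx sB sB' M0; congr Seed.
- apply/ffunP => i; case: (eqVneq i k) => [->|ik]; last by rewrite !mut_x_other.
  rewrite mut_xE // exch_poly_mutation // (@eval_exch_poly _ _ _ x); last first.
    by rewrite /= mut_x_other // rev_ord2_neq.
  rewrite [seed_x _ _]mut_xE //; exact: divr_divr_cancel.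
- apply/ffunP => i; rewrite !ffunE eqxx; case: (eqVneq i k) => [->|/ord2_case ->].
    by rewrite invgK.
  rewrite /= mut_B2 // mxE opprK oplus_invr.
  exact: expgz_mutationK.
- by rewrite /= mut_B2 // mut_B2 // opprK.
Qed.

(* The seed at a word is obtained by mutating along it, starting from the seed at
   the root, which is itself reached from [t0] by mutating back along [t0]. *)
Lemma cluster_pattern_exists (t0 : tree 2) sd : is_labeled_seed sd ->
  exists Sigma : tree 2 -> seed P K 2, cluster_pattern e Sigma /\ Sigma t0 = sd.
Proof.
move=> lsd; pose mutw (w : seq 'I_2) sd := foldr (fun k s => mutation e k s) sd w.
have mutw_lab w s : is_labeled_seed s -> is_labeled_seed (mutw w s).
  by move=> ls; elim: w => //= k w; exact: mutation_labeled_seed.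
have mutwK w s : is_labeled_seed s -> mutw w (mutw (rev w) s) = s.
  elim: w s => //= k w IH s ls; rewrite rev_cons /mutw foldr_rcons -/(mutw _ _).
  by rewrite -/(mutw _ _) IH ?mutation_involutive //; exact: mutation_labeled_seed.
pose root := mutw (rev (val t0)) sd.
have lroot : is_labeled_seed root by exact: mutw_lab.
exists (fun t => mutw (val t) root); split; last exact: mutwK.
split=> [t|[w wr] k]; first exact: mutw_lab.
case: w wr => [|a w] wr //=; case: eqP => [->|] //.
by rewrite mutation_involutive //; exact: mutw_lab.
Qed.

End MutationRank2.

(** * F-polynomials *)

Section ValueAtOnes.
Variables (K : fieldType) (n : nat).
Implicit Types (z : ratfun K n) (c : K).

Let tof0 (p : {mpoly K[n]}) : p.@[fun=> 1] != 0 -> p%:F != 0.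
Proof. by move=> p0; rewrite tofrac_eq0; apply: contraNneq p0 => ->; rewrite meval0. Qed.

Lemma value_at_ones_uniq z c c' : value_at_ones z c -> value_at_ones z c' -> c = c'.
Proof.
move=> [p [q [-> q0 ->]]] [p' [q' [E q'0 ->]]].
apply/eqP; rewrite eqr_div // -!mevalM; apply/eqP; congr (meval _ _).
apply/eqP; rewrite -tofrac_eq !tofracM -eqr_div ?tof0 //; exact/eqP.
Qed.

Lemma value_at_onesC c : value_at_ones (ratfunC n c) c.
Proof.
exists c%:MP, 1; rewrite meval1 oner_neq0 mevalC; split=> //; last by rewrite divr1.
by rewrite rmorph1 divr1.
Qed.

Lemma value_at_ones_var i : value_at_ones ('X_i : {mpoly K[n]})%:F 1.
Proof.
exists 'X_i, 1; rewrite meval1 oner_neq0 mevalXU; split=> //; last by rewrite divr1.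
by rewrite rmorph1 divr1.
Qed.

Lemma value_at_onesD z z' c c' :
  value_at_ones z c -> value_at_ones z' c' -> value_at_ones (z + z') (c + c').
Proof.
move=> [p [q [-> q0 ->]]] [p' [q' [-> q'0 ->]]].
exists (p * q' + p' * q), (q * q'); split; last first.
- by rewrite mevalD !mevalM addf_div.
- by rewrite mevalM mulf_neq0.
by rewrite tofracD !tofracM addf_div ?tof0.
Qed.

Lemma value_at_onesM z z' c c' :
  value_at_ones z c -> value_at_ones z' c' -> value_at_ones (z * z') (c * c').
Proof.
move=> [p [q [-> q0 ->]]] [p' [q' [-> q'0 ->]]].
exists (p * p'), (q * q'); split; last first.
- by rewrite !mevalM mulf_div.
- by rewrite mevalM mulf_neq0.
by rewrite !tofracM mulf_div.
Qed.

Lemma value_at_onesV z c : c != 0 -> value_at_ones z c -> value_at_ones z^-1 c^-1.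
Proof.
move=> c0 [p [q [-> q0 Ec]]]; exists q, p; split; rewrite ?Ec ?invf_div //.
by apply: contraNneq c0 => p0; rewrite Ec p0 mul0r.
Qed.

Lemma value_at_onesX z c k : value_at_ones z c -> value_at_ones (z ^+ k) (c ^+ k).
Proof.
move=> zc; elim: k => [|k IH]; last by rewrite !exprS; exact: value_at_onesM.
by rewrite !expr0 -(ratfunC1 K n); exact: value_at_onesC.
Qed.

End ValueAtOnes.

Section TropicalCoefficients.
Variable n : nat.
Implicit Types (c : trop n) (m : 'X_{1..n}).

(** Tropically [oplus 1 c] has exponents [min 0 (c i)]; hence its inverse and the quotient
    [c / oplus 1 c] are honest monomials, with the exponents [neg_mnm c] and [pos_mnm c]. *)
Definition neg_mnm c : 'X_{1..n} := [multinom `|Num.max (- c i) 0|%N | i < n].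
Definition pos_mnm c : 'X_{1..n} := [multinom `|Num.max (c i) 0|%N | i < n].

Let e1 := frac_group_ring1 (trop_frac_group_ring n).
Let eM := frac_group_ringM (trop_frac_group_ring n).

Lemma trop_embed_mnm m : trop_embed [ffun i => (m i)%:Z] = ('X_[m] : {mpoly int[n]})%:F.
Proof.
rewrite mpolyXE_id rmorph_prod; apply: eq_bigr => i _.
by rewrite ffunE -exprnP rmorphXn.
Qed.

Let trop_eV c : trop_embed c^-1%g = (trop_embed c)^-1.
Proof.
have c0 : trop_embed c != 0.
  apply/eqP => c0; have := eM c c^-1%g; rewrite mulgV e1 c0 mul0r; exact/eqP/oner_neq0.
by apply: (mulfI c0); rewrite -eM mulgV e1 mulfV.
Qed.

Lemma trop_embed_neg c : (trop_embed (oplus 1%g c))^-1 = ('X_[neg_mnm c] : {mpoly int[n]})%:F.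
Proof.
rewrite -trop_eV -trop_embed_mnm; congr trop_embed; apply/ffunP => i.
by rewrite !ffunE mnmE; lia.
Qed.

Lemma trop_embed_pos c :
  trop_embed c / trop_embed (oplus 1%g c) = ('X_[pos_mnm c] : {mpoly int[n]})%:F.
Proof.
rewrite -trop_eV -eM -trop_embed_mnm; congr trop_embed; apply/ffunP => i.
by rewrite !ffunE mnmE; lia.
Qed.

End TropicalCoefficients.

(* The Laurent phenomenon in rank 2: modulo [f2], the third relation multiplied by
   [Q0] vanishes by the first two and the compatibility of the coefficients. *)
Lemma exchange_divides (R : comNzRingType) (f0 f1 f2 f3 Q0 Q1 Q2 P0 P1 P2 : R) (a b : nat) :
  (0 < b)%N -> f2 * f0 = Q0 + P0 * f1 ^+ a -> f3 * f1 = Q1 + P1 * f2 ^+ b ->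
  Q1 ^+ a * P0 * P2 = Q0 * Q2 ->
  exists A, f2 * A = Q0 * (Q2 + P2 * f3 ^+ a).
Proof.
case: b => // b _ E0 E1 EQ.
have [W EW] : exists W, (Q1 + P1 * f2 ^+ b.+1) ^+ a = Q1 ^+ a + f2 * W.
  (* This is the factorization of a difference of [a]-th powers with one factor [f2] removed from
     [P1 * f2 ^+ b.+1]. *)
  exists (P1 * f2 ^+ b * \sum_(i < a) (Q1 + P1 * f2 ^+ b.+1) ^+ (a.-1 - i) * Q1 ^+ i).
  rewrite -[LHS](subrK (Q1 ^+ a)) subrXX addrC; congr (_ + _).
  by rewrite exprS; ring.
exists (P2 * (f0 * f3 ^+ a - P0 * W)).
have -> : f2 * (P2 * (f0 * f3 ^+ a - P0 * W)) =
    P2 * ((f2 * f0) * f3 ^+ a - P0 * (f2 * W)) by ring.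
have -> : f2 * W = (f3 * f1) ^+ a - Q1 ^+ a by rewrite E1 EW addrAC subrr add0r.
rewrite E0 exprMn.
have -> : P2 * ((Q0 + P0 * f1 ^+ a) * f3 ^+ a - P0 * (f3 ^+ a * f1 ^+ a - Q1 ^+ a))
  = Q0 * P2 * f3 ^+ a + Q1 ^+ a * P0 * P2 by ring.
by rewrite EQ; ring.
Qed.

(** * Polynomiality and degrees from the specialized exchange recurrence *)

Section FSequence.
Variables (n : nat) (q p : nat -> 'X_{1..n}) (a : nat -> nat).
Variable G : nat -> {fraction {mpoly int[n]}}.
Let Q m : {mpoly int[n]} := 'X_[q m].
Let P m : {mpoly int[n]} := 'X_[p m].
Hypothesis a_per : forall m, a m.+2 = a m.
Hypothesis qpE : forall m,
  'X_[q m.+1] ^+ a m.+1 * 'X_[p m] * 'X_[p m.+2] = 'X_[q m] * 'X_[q m.+2] :> {mpoly int[n]}.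
Hypotheses (G0 : G 0 = 1) (G1 : G 1 = 1).
Hypothesis GE : forall m,
  G m.+2 = (('X_[q m])%:F + ('X_[p m])%:F * G m.+1 ^+ a m.+1) / G m.

Section Degree.
Variables (w : 'X_{1..n} -> int) (d : nat -> int) (J : nat).
Hypothesis wD : forall m1 m2, w (m1 + m2)%MM = w m1 + w m2.
Hypotheses (d0 : d 0 = 0) (d1 : d 1 = 0).
Hypothesis dE : forall m, (m.+2 <= J)%N ->
  d m.+2 + d m = Num.max (w (q m)) (w (p m) + d m.+1 *+ a m.+1).

(* Subtraction-free quotients: nonnegative coefficients exclude cancellation of
   leading terms, so that degrees of sums are maxima. *)
Definition sf_deg (g : {fraction {mpoly int[n]}}) (c : int) : Prop :=
  exists A B (cA cB : int), [/\ coef_nonneg A /\ coef_nonneg B, has_top w A cA,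
    has_top w B cB, g * B%:F = A%:F & c = cA - cB].

Let sf_degM g g' c c' : sf_deg g c -> sf_deg g' c' -> sf_deg (g * g') (c + c').
Proof.
move=> [A [B [cA [cB [[nA nB] tA tB E ->]]]]] [A' [B' [cA' [cB' [[nA' nB'] tA' tB' E' ->]]]]].
exists (A * A'), (B * B'), (cA + cA'), (cB + cB'); split.
- by split; exact: coef_nonnegM.
- exact: has_topM.
- exact: has_topM.
- by rewrite !rmorphM /= -E -E' mulrACA.
- by ring.
Qed.

Let sf_degD g g' c c' : sf_deg g c -> sf_deg g' c' -> sf_deg (g + g') (Num.max c c').
Proof.
move=> [A [B [cA [cB [[nA nB] tA tB E ->]]]]] [A' [B' [cA' [cB' [[nA' nB'] tA' tB' E' ->]]]]].
exists (A * B' + A' * B), (B * B'), (Num.max (cA + cB') (cA' + cB)), (cB + cB'); split.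
- by split; [apply: coef_nonnegD|]; exact: coef_nonnegM.
- by apply: has_topD_nonneg; first [exact: coef_nonnegM | exact: has_topM].
- exact: has_topM.
- rewrite rmorphD !rmorphM /= -E -E'; move: (B%:F) (B'%:F) => b b'.
  by rewrite mulrDl; congr (_ + _); rewrite -!mulrA; congr (_ * _); rewrite mulrC.
- by lia.
Qed.

Let sf_deg_poly A c : coef_nonneg A -> has_top w A c -> sf_deg A%:F c.
Proof.
move=> nA tA; exists A, 1, c, 0; split=> //; first by split=> //; exact: coef_nonneg1.
- exact: has_topC.
- by rewrite rmorph1 mulr1.
- by rewrite subr0.
Qed.

Let sf_deg1 : sf_deg 1 0.
Proof.
rewrite -(rmorph1 (@FracField.tofrac _)); apply: sf_deg_poly; first exact: coef_nonneg1.
exact: has_topC.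
Qed.

Let sf_degX g c k : sf_deg g c -> sf_deg (g ^+ k) (c *+ k).
Proof.
by move=> gc; elim: k => [|k IH]; [exact: sf_deg1 | rewrite exprS mulrS; exact: sf_degM].
Qed.

Let sf_degV g c : sf_deg g c -> sf_deg g^-1 (- c).
Proof.
move=> [A [B [cA [cB [[nA nB] tA tB E ->]]]]].
exists B, A, cB, cA; split=> //; last by rewrite opprB.
have [A0 B0] := (has_top_neq0 tA, has_top_neq0 tB).
have g0 : g != 0 by apply: contraNneq A0 => g0; rewrite -tofrac_eq0 -E g0 mul0r.
by rewrite -E mulKf.
Qed.

Lemma F_sequence_sf_deg j : (j <= J)%N -> sf_deg (G j) (d j).
Proof.
elim/ltn_ind: j => -[|[|m]] IH jJ.
- by rewrite G0 d0.
- by rewrite G1 d1.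
have -> : d m.+2 = Num.max (w (q m)) (w (p m) + d m.+1 *+ a m.+1) + - d m.
  by rewrite -dE //; ring.
have mon k : sf_deg ('X_[k])%:F (w k).
  by apply: sf_deg_poly; [exact: coef_nonneg_mon | exact: has_top_mon].
rewrite GE; apply: sf_degM; last by apply: sf_degV; apply: IH => //; lia.
by apply: sf_degD => //; apply: sf_degM => //; apply: sf_degX; apply: IH => //; lia.
Qed.

End Degree.

(** The degree computation for the zero weight already exhibits a nonzero numerator. *)
Lemma F_sequence_neq0 m : G m != 0.
Proof.
have dE k : (k.+2 <= m)%N -> 0 + 0 = Num.max 0 (0 + 0 *+ a k.+1) :> int.
  by rewrite mul0rn addr0 maxxx.
have wD (m1 m2 : 'X_{1..n}) : 0 = 0 + 0 :> int by rewrite addr0.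
have [A [B [cA [cB [_ tA _ E _]]]]] :=
  @F_sequence_sf_deg (fun=> 0) (fun=> 0) m wD erefl erefl dE m (leqnn m).
by apply: contraNneq (has_top_neq0 tA) => G00; rewrite -tofrac_eq0 -E G00 mul0r.
Qed.

Let GM m : G m.+2 * G m = ('X_[q m])%:F + ('X_[p m])%:F * G m.+1 ^+ a m.+1.
Proof. by rewrite GE divfK // F_sequence_neq0. Qed.

(** The degree is computed on a subtraction-free quotient [A / B] and transferred to [f] through
    [f * B = A], by additivity of tops. *)
Lemma F_sequence_degree i (d : nat -> int) j f : d 0 = 0 -> d 1 = 0 ->
  (forall m, (m.+2 <= j)%N -> d m.+2 + d m = Num.max (q m i)%:Z ((p m i)%:Z + d m.+1 *+ a m.+1)) ->
  G j = f%:F -> (deg_in i f)%:Z = d j.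
Proof.
move=> d0 d1 dE Gf; pose w (m : 'X_{1..n}) : int := (m i)%:Z.
have wD m1 m2 : w (m1 + m2)%MM = w m1 + w m2 by rewrite /w mnmDE PoszD.
have [A [B [cA [cB [_ tA tB E ->]]]]] := F_sequence_sf_deg wD d0 d1 dE (leqnn j).
have f0 : f != 0 by rewrite -tofrac_eq0 -Gf F_sequence_neq0.
have [c tf] := has_top_ex w f0; rewrite (has_top_deg_in tf).
have fBA : f * B = A by apply/eqP; rewrite -tofrac_eq rmorphM /= -Gf E.
by have := has_topM wD tf tB; rewrite fBA => /(has_top_uniq tA) ->; ring.
Qed.

(** Exactly one of the two monomials of each relation is trivial, which keeps the constant terms
    equal to 1. A polynomial with constant term 1 is coprime to monomials, so the divisibility of
    [exchange_divides] survives removal of its monomial factor. Up to index 3 the divisors are [G 0]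
    and [G 1], equal to 1; later indices use positive exponents. *)
Lemma F_polynomial_exists N :
  (forall m, (m <= N)%N -> (q m == 0%MM) != (p m == 0%MM)) ->
  (forall m, 0 < a m)%N \/ (N <= 1)%N ->
  forall j, (j <= N.+2)%N -> exists2 f, G j = f%:F & f@_0%MM = 1.
Proof.
move=> qp0 aN; elim/ltn_ind=> j IH jN.
have const m f : (m <= N)%N -> f@_0%MM = 1 ->
    (Q m + P m * f ^+ a m.+1)@_0%MM = 1.
  move=> /qp0; rewrite rmorphD rmorphM rmorphXn /= !mcoeffX => + ->.
  by rewrite expr1n mulr1; case: (q m == _); case: (p m == _).
have GEf m f : G m.+1 = f%:F -> G m.+2 * G m = (Q m + P m * f ^+ a m.+1)%:F.
  by move=> Ef; rewrite GM Ef rmorphD rmorphM rmorphXn.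
have c1 : (1 : {mpoly int[n]})@_0%MM = 1 by rewrite mcoeff1 eqxx.
case: j => [|[|[|[|m]]]] in IH jN *.
- by exists 1; rewrite ?G0 ?rmorph1.
- by exists 1; rewrite ?G1 ?rmorph1.
- exists (Q 0 + P 0 * 1 ^+ a 1); last exact: const.
  by rewrite -GEf ?G0 ?mulr1 ?G1 ?rmorph1.
- have [//|//|f Ef f0] := IH 2; exists (Q 1 + P 1 * f ^+ a 2); last by apply: const.
  by rewrite -GEf // G1 mulr1.
have [||f0 E0 _] := IH m; [lia..|]; have [||f1 E1 _] := IH m.+1; [lia..|].
have [||f2 E2 c2] := IH m.+2; [lia..|]; have [||f3 E3 c3] := IH m.+3; [lia..|].
have fE k f f' f'' : G k = f%:F -> G k.+1 = f'%:F -> G k.+2 = f''%:F ->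
    f'' * f = Q k + P k * f' ^+ a k.+1.
  move=> Ef Ef' Ef''; apply/eqP; rewrite -tofrac_eq rmorphM /= -Ef -Ef''.
  by rewrite (GEf _ _ Ef').
have a0 : (0 < a m)%N by case: aN => // ?; lia.
have R0 := fE _ _ _ _ E0 E1 E2; have R1 := fE _ _ _ _ E1 E2 E3.
rewrite a_per in R1.
have [A EA] := exchange_divides a0 R0 R1 (qpE m).
have f20 : f2@_0%MM != 0 by rewrite c2.
have [C EC] := mpolyX_Gauss f20 EA.
have Q0 : 'X_[q m] != 0 :> {mpoly int[n]} by rewrite -msupp_eq0 msuppX.
have f2n0 : f2 != 0 by apply: contraNneq f20 => ->; rewrite mcoeff0.
have CE : C * f2 = Q m.+2 + P m.+2 * f3 ^+ a m.+1.
  by apply: (mulfI Q0); rewrite mulrA -EC -EA mulrC.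
exists C.
  apply: (@mulIf _ f2%:F); first by rewrite tofrac_eq0.
  by rewrite -rmorphM /= CE -E2 (GEf _ _ E3) a_per.
have := congr1 (mcoeff 0%MM) CE; rewrite rmorphM /= c2 mulr1 => ->.
by rewrite -[a m.+1]a_per; apply: const => //; lia.
Qed.

End FSequence.

(** For [c] constant equal to [b] these are the Chebyshev polynomials of the second kind evaluated
    at [b / 2], preceded by 0. *)
Fixpoint chain (c : nat -> nat) (m : nat) : int :=
  match m with
  | 0 => 0
  | 1 => 1
  | (m''.+1 as m').+1 => (c m'')%:Z * chain c m' - chain c m''
  end.

Lemma chainE c m : chain c m.+2 = (c m)%:Z * chain c m.+1 - chain c m.
Proof. by []. Qed.

Lemma eq_div_of_mul (F : fieldType) (v w c d : F) :
  w != 0 -> v * w = c / d -> v = c * d^-1 * w^-1.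
Proof. by move=> w0 <-; rewrite mulfK. Qed.

(** * Principal coefficients along a walk *)

Section PrincipalLine.
Variables (B : 'M[int]_2) (t : tree 2) (k : 'I_2).
Variable Sigma : tree 2 -> seed (trop 2) (trop_field 2) 2.
Hypothesis HSigma : cluster_pattern (@trop_embed 2) Sigma.
Hypothesis Sigma_t : Sigma t = trop_initial_seed B.

Let e1 := frac_group_ring1 (trop_frac_group_ring 2).
Let eM := frac_group_ringM (trop_frac_group_ring 2).
Let a := line_a Sigma t k.
Let z := line_z Sigma t k.
Let x := line_x Sigma t k.
Let s := 0 <= B k (rev_ord k).
Let exch := line_exchange e1 eM HSigma t k.
Let a_per m : a m.+2 = a m. Proof. exact: exch_per exch m. Qed.

Let expg_ffun (c : trop 2) r i : (c ^+ r)%g i = c i *+ r.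
Proof.
by elim: r => [|r IH]; [rewrite expg0 ffunE | rewrite expgS ffunE IH mulrS].
Qed.

Let zE m i : z m.+2 i + z m i = (a m.+1)%:Z * Num.min 0 (z m.+1 i).
Proof.
rewrite -[(a _)%:Z]natz mulr_natl.
have := congr1 (fun c : trop 2 => c i) (exch_zE exch m).
by rewrite /= expg_ffun !ffunE.
Qed.

Let z0E i : z 0 i = if s then - (k == i)%:Z else (k == i)%:Z.
Proof.
rewrite /z line_z0 Sigma_t /= -/s; case: (boolP s) => _; by rewrite !ffunE.
Qed.

Let z1E i : z 1 i + (if s then (rev_ord k == i)%:Z else - (rev_ord k == i)%:Z)
  = (a 0)%:Z * Num.min 0 (z 0 i).
Proof.
rewrite -[(a _)%:Z]natz mulr_natl.
have := congr1 (fun c : trop 2 => c i) (line_z1 HSigma t k).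
by rewrite Sigma_t /= -/s expg_ffun; case: (boolP s) => _; rewrite !ffunE.
Qed.

Let u := chain a.
Let u' := chain (fun m => a m.+1).

Section Range.
Variable N : nat.
Hypothesis u_ge0 : forall m, (m <= N)%N -> 0 <= u m.+1.
Hypothesis u'_ge0 : forall m, (m <= N)%N -> 0 <= u' m.
Hypothesis uu'_gt0 : forall m, (m <= N)%N -> 0 < u m.+1 + u' m.

Let uE m : u m.+2 = (a m)%:Z * u m.+1 - u m. Proof. by []. Qed.
Let u'E m : u' m.+2 = (a m.+1)%:Z * u' m.+1 - u' m. Proof. by []. Qed.

Let chain_step (c v v' w w' r r' : int) : v' + - w' = - (c * r') -> v + - w = - (c * r) ->
  v = - (c * r - w) /\ v' = - (c * r' - w').
Proof. by lia. Qed.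

Let two_step (Q : nat -> Prop) : Q 0 -> Q 1 -> (forall m, Q m -> Q m.+1 -> Q m.+2) ->
  forall m, Q m.
Proof.
move=> Q0 Q1 QS m; suff [] : Q m /\ Q m.+1 by [].
by elim: m => // m [Qm Qm']; split=> //; exact: QS.
Qed.

Let bT : (true : nat)%:Z = 1. Proof. by []. Qed.
Let bF : (false : nat)%:Z = 0. Proof. by []. Qed.
Let kk : (k == k) = true. Proof. exact: eqxx. Qed.
Let kr : (k == rev_ord k) = false. Proof. by rewrite eq_sym (negbTE (rev_ord2_neq k)). Qed.
Let rk : (rev_ord k == k) = false. Proof. exact: negbTE (rev_ord2_neq k). Qed.

(** As long as the exponents are nonpositive, the minimum with 0 is the exponent itself and the
    tropical recurrence becomes the linear recurrence of the chains. *)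
Let z_pos m : s -> (m <= N)%N -> z m k = - u m.+1 /\ z m (rev_ord k) = - u' m.
Proof.
move=> ss; elim/two_step: m => [_|_|m IH IH' mN].
- by rewrite !z0E ss kk kr.
- have := z1E k; have := z1E (rev_ord k); rewrite !z0E ss kk kr rk eqxx bT bF uE.
  rewrite -[u' 1]/1 -[u 1]/1 -[u 0]/0 oppr0 minxx mulr0 min_r //.
  by move: (z 1 k) (z 1 (rev_ord k)) (a 0) => v v' n; lia.
have [E E'] := IH' (ltnW mN); have [F F'] := IH (ltnW (ltnW mN)).
have := zE m k; have := zE m (rev_ord k); rewrite E E' F F'.
have := uE m.+1; have := u'E m => -> ->.
have := u_ge0 (ltnW mN); have := u'_ge0 (ltnW mN) => h h'.
rewrite !min_r ?oppr_le0 // !mulrN.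
exact: chain_step.
Qed.

Let z_neg01 : ~~ s ->
  [/\ z 0 k = 1, z 0 (rev_ord k) = 0, z 1 k = 0 & z 1 (rev_ord k) = 1].
Proof.
  move=> ss; have := z1E k; have := z1E (rev_ord k); rewrite !z0E (negbTE ss) kk kr rk eqxx bT bF.
  rewrite minxx min_l // !mulr0.
  by move: (z 1 k) (z 1 (rev_ord k)) => v v'; split; lia.
Qed.

(** For the other sign the first two coefficients are the initial variables themselves; after them
    the same exponents appear with a delay of two steps. *)
Let z_neg m : ~~ s -> (m.+2 <= N)%N ->
  z m.+2 k = - u m.+1 /\ z m.+2 (rev_ord k) = - u' m.
Proof.
move=> ss; have [z0k z0r z1k z1r] := z_neg01 ss.
have z2k : z 2 k = -1 /\ z 2 (rev_ord k) = 0.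
  have := zE 0 k; have := zE 0 (rev_ord k); rewrite z0k z0r z1k z1r.
  rewrite minxx min_l // !mulr0.
  by move: (z 2 k) (z 2 (rev_ord k)) => v v'; split; lia.
have [z2k' z2r] := z2k.
elim/two_step: m => [_|_|m IH IH' mN].
- by rewrite z2k' z2r.
- have := zE 1 k; have := zE 1 (rev_ord k); rewrite z1k z1r z2k' z2r uE a_per.
  rewrite -[u' 1]/1 -[u 1]/1 -[u 0]/0 minxx min_r // mulr0.
  by move: (z 3 k) (z 3 (rev_ord k)) (a 0) => v v' n; lia.
have [E E'] := IH' (ltnW mN); have [F F'] := IH (ltnW (ltnW mN)).
have := zE m.+2 k; have := zE m.+2 (rev_ord k); rewrite E E' F F'.
have := uE m.+1; have := u'E m; rewrite !a_per => -> ->.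
have := @u_ge0 m.+1; have := @u'_ge0 m.+1 => /(_ ltac:(lia)) h /(_ ltac:(lia)) h'.
rewrite !min_r ?oppr_le0 // !mulrN.
exact: chain_step.
Qed.


Let q m := neg_mnm (z m).
Let p m := pos_mnm (z m).
Let qE m i : (q m i)%:Z = Num.max (- z m i) 0.
Proof. by rewrite mnmE; lia. Qed.
Let pE m i : (p m i)%:Z = Num.max (z m i) 0.
Proof. by rewrite mnmE; lia. Qed.

(** On exponents this is the tropical recurrence, each exponent being the difference of its positive
    and negative parts. *)
Let qpE m : 'X_[q m.+1] ^+ a m.+1 * 'X_[p m] * 'X_[p m.+2] =
  'X_[q m] * 'X_[q m.+2] :> {mpoly int[2]}.
Proof.
rewrite mpolyXn -!mpolyXD; congr ('X_[_]); apply/mnmP => i.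
apply/eqP; rewrite -eqz_nat !mnmDE mulmnE !PoszD PoszM !pE !qE; apply/eqP.
have := zE m i; move: (z m i) (z m.+1 i) (z m.+2 i) (a m.+1) => z0 z1 z2 c.
have -> : Num.max (- z1) 0 = - Num.min 0 z1 by lia.
by move: (Num.min 0 z1) => b E; rewrite mulNr [b * _]mulrC -E; lia.
Qed.

Let Gpair := fix Gpair m : trop_field 2 * trop_field 2 :=
  if m is m'.+1 then
    let: (g, g') := Gpair m' in
    (g', (('X_[q m'] : {mpoly int[2]})%:F
          + ('X_[p m'] : {mpoly int[2]})%:F * g' ^+ a m'.+1) / g)
  else (1, 1).
Let G m := (Gpair m).1.

Let GE m : G m.+2 = (('X_[q m] : {mpoly int[2]})%:F
  + ('X_[p m] : {mpoly int[2]})%:F * G m.+1 ^+ a m.+1) / G m.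
Proof. by rewrite /G /=; case: (Gpair m). Qed.

Let G_neq0 := F_sequence_neq0 (erefl : G 0 = 1) (erefl : G 1 = 1) GE.

Let e_neq0 c : trop_embed c != 0 :> trop_field 2.
Proof.
apply/eqP => c0; have := eM c c^-1%g; rewrite mulgV e1 c0 mul0r; exact/eqP/oner_neq0.
Qed.

Let G_value j : value_at_ones (x j) (G j).
Proof.
elim/two_step: j => [||m IH IH'].
- by rewrite /x /line_x Sigma_t ffunE; exact: value_at_ones_var.
- by rewrite /x -(line_xS HSigma t k 0) Sigma_t ffunE; exact: value_at_ones_var.
have -> : x m.+2 = (1 + ratfunC 2 (trop_embed (z m)) * x m.+1 ^+ a m.+1)
    * (ratfunC 2 (trop_embed (oplus 1%g (z m))))^-1 * (x m)^-1.
  by apply: eq_div_of_mul (exch_xE exch m); exact: line_x_neq0 HSigma _ _ _.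
have -> : G m.+2 = (1 + trop_embed (z m) * G m.+1 ^+ a m.+1)
    * (trop_embed (oplus 1%g (z m)))^-1 * (G m)^-1.
  rewrite GE -trop_embed_neg -trop_embed_pos; congr (_ * _).
  by rewrite [RHS]mulrDl mul1r; congr (_ + _); rewrite mulrAC.
apply: value_at_onesM; last by apply: value_at_onesV; [exact: G_neq0 | exact: IH].
apply: value_at_onesM; last by apply: value_at_onesV; [exact: e_neq0 | exact: value_at_onesC].
apply: value_at_onesD; first by rewrite -(ratfunC1 _ 2); exact: value_at_onesC.
by apply: value_at_onesM; [exact: value_at_onesC | exact: value_at_onesX].
Qed.

(** Every exponent vector [z m] in the range is nonzero with entries of a single sign, so one of its
    positive and negative parts is trivial and the other is not. *)
Let sign_coherent m : (m <= N)%N -> (q m == 0%MM) != (p m == 0%MM).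
Proof.
have eq0 (c : 'X_{1..2}) : (c == 0%MM) = (c k == 0%N) && (c (rev_ord k) == 0%N).
  apply/eqP/andP => [->|[/eqP ck /eqP cr]]; first by rewrite !mnm0E.
  by apply/mnmP => i; rewrite mnm0E; case: (eqVneq i k) => [->|/ord2_case ->].
rewrite !eq0 -!eqz_nat !qE !pE => mN.
case: (boolP s) => [ss|ns].
  have [-> ->] := z_pos ss mN; have := u_ge0 mN; have := u'_ge0 mN; have := uu'_gt0 mN.
  by move: (u m.+1) (u' m) => v v' *; lia.
have [z0k z0r z1k z1r] := z_neg01 ns.
case: m mN => [|[|m]] mN; first by rewrite z0k z0r.
  by rewrite z1k z1r.
have [-> ->] := z_neg ns mN; have mN' : (m <= N)%N by lia.
have := u_ge0 mN'; have := u'_ge0 mN'; have := uu'_gt0 mN'.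
by move: (u m.+1) (u' m) => v v' *; lia.
Qed.

Let u_ge0' m : (m <= N.+1)%N -> 0 <= u m.
Proof. by case: m => // m; exact: u_ge0. Qed.

Let chain_max (v w cw : int) : v = cw - w -> 0 <= w -> v + w = Num.max v cw.
Proof. by lia. Qed.

Let chain_max' (v w cw : int) : v = cw - w -> 0 <= v -> v + w = Num.max w cw.
Proof. by lia. Qed.

(** Truncated predecessors encode the initial values: [m.-1] is 0 for both initial variables, and in
    the companion [degr] the index [m.-2] is 0 up to [m = 2]. *)
Let degk j : (j <= N.+2)%N -> forall m, (m.+2 <= j)%N ->
  u m.+2.-1 + u m.-1 = Num.max (q m k)%:Z ((p m k)%:Z + u m.+1.-1 *+ a m.+1).
Proof.
move=> jN m mj; rewrite /= qE pE -mulr_natl natz.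
have mN : (m <= N)%N by lia.
have um := u_ge0 mN.
case: (boolP s) => [ss|ns].
  have [-> _] := z_pos ss mN.
  rewrite opprK [Num.max (u _) 0]max_l // [Num.max (- _) 0]max_r ?oppr_le0 // add0r.
  case: m mj mN um => [|m] mj mN um; first by rewrite -[u 0]/0 mulr0 addr0 max_l.
  by apply: chain_max; [rewrite uE a_per | apply: u_ge0'; lia].
have [z0k z0r z1k z1r] := z_neg01 ns.
case: m mj mN um => [|[|m]] mj mN um.
- by rewrite z0k -[u 0]/0 mulr0 !addr0.
- rewrite z1k oppr0 maxxx add0r -[u 0]/0 -[u 1]/1 uE -[u 0]/0 -[u 1]/1 a_per.
  by rewrite mulr1 subr0 addr0 max_r.
have [-> _] := z_neg ns mN; have um' : 0 <= u m.+1 by apply: u_ge0; lia.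
rewrite opprK [Num.max (u _) 0]max_l // [Num.max (- _) 0]max_r ?oppr_le0 // add0r.
by apply: chain_max'; [rewrite uE !a_per | ].
Qed.

Let degr j : (j <= N.+2)%N -> forall m, (m.+2 <= j)%N ->
  u' m.+2.-2 + u' m.-2 =
  Num.max (q m (rev_ord k))%:Z ((p m (rev_ord k))%:Z + u' m.+1.-2 *+ a m.+1).
Proof.
move=> jN m mj; rewrite /= qE pE -mulr_natl natz.
have mN : (m <= N)%N by lia.
have um := u'_ge0 mN.
case: (boolP s) => [ss|ns].
  have [_ ->] := z_pos ss mN.
  rewrite opprK [Num.max (u' _) 0]max_l // [Num.max (- _) 0]max_r ?oppr_le0 // add0r.
  case: m mj mN um => [|[|m]] mj mN um.
  - by rewrite -[u' 0]/0 mulr0 addr0 maxxx.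
  - by rewrite -[u' 0]/0 -[u' 1]/1 mulr0 addr0 max_l.
  by apply: chain_max; [rewrite u'E a_per | apply: u'_ge0; lia].
have [z0k z0r z1k z1r] := z_neg01 ns.
case: m mj mN um => [|[|m]] mj mN um.
- by rewrite z0r oppr0 -[u' 0]/0 mulr0 !addr0 maxxx.
- by rewrite z1r -[u' 0]/0 -[u' 1]/1 mulr0 !addr0 max_r.
have [_ ->] := z_neg ns mN; have um' : 0 <= u' m by apply: u'_ge0; lia.
rewrite opprK [Num.max (u' _) 0]max_l // [Num.max (- _) 0]max_r ?oppr_le0 // add0r.
by apply: chain_max'; [rewrite u'E !a_per | ].
Qed.

Lemma principal_line j : (forall m, 0 < a m)%N \/ (N <= 1)%N -> (j <= N.+2)%N ->
  exists f : {mpoly int[2]}, [/\ value_at_ones (line_x Sigma t k j) f%:F,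
    (deg_in k f)%:Z = chain a j.-1 &
    (deg_in (rev_ord k) f)%:Z = chain (fun m => a m.+1) j.-2].
Proof.
move=> aN jN.
have [f Gf _] := F_polynomial_exists a_per qpE erefl erefl GE sign_coherent aN jN.
exists f; split; first by rewrite -Gf; exact: G_value.
  exact: (@F_sequence_degree _ q p a G erefl erefl GE k (fun j => u j.-1)
    j f erefl erefl (degk jN) Gf).
exact: (@F_sequence_degree _ q p a G erefl erefl GE (rev_ord k) (fun j => u' j.-2)
  j f erefl erefl (degr jN) Gf).
Qed.

End Range.
End PrincipalLine.

(** * Distinct cluster variables *)

Section ChainPositive.
Variable c : nat -> nat.
Hypothesis c_per : forall m, c m.+2 = c m.
Hypothesis c4 : forall m, (4 <= c m * c m.+1)%N.

(* With [c m * c m.+1 >= 4] the ratios [chain c m.+1 / chain c m] stay above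
   [c m.+1 / 2]. *)
Let ratio m : [/\ 0 <= chain c m, 0 < chain c m.+1 &
  (c m.+1)%:Z * chain c m <= 2 * chain c m.+1].
Proof.
elim: m => [|m [u0 u1 r]]; first by rewrite /= mulr0.
rewrite chainE c_per; move: (chain c m) (chain c m.+1) (c m) (c m.+1) (c4 m) u0 u1 r.
by move=> v w x y xy v0 w0 r; split; nia.
Qed.

Lemma chain_gt0 m : 0 < chain c m.+1. Proof. by case: (ratio m). Qed.

Lemma chain_ge0 m : 0 <= chain c m. Proof. by case: (ratio m). Qed.

(** The chain is nondecreasing along each parity class, which leaves the terms 3 and 4; these are
    [x * y - 1] and [x * (x * y - 2)] for [x = c 0] and [y = c 1]. *)
Lemma chain_ge2 m : 2 <= chain c m.+3.
Proof.
suff [] : 2 <= chain c m.+3 /\ 2 <= chain c m.+4 by [].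
have mono i : chain c i <= chain c i.+2.
  have [v0 _ _] := ratio i; have [_ w0 r] := ratio i; rewrite chainE.
  move: (chain c i) (chain c i.+1) (c i) (c i.+1) (c4 i) v0 w0 r => v w x y xy v0 w0 r.
  by nia.
have [x [y [E0 E1]]] : exists x y, c 0 = x /\ c 1 = y by exists (c 0), (c 1).
have xy := c4 0; rewrite E0 E1 in xy.
elim: m => [|m [IH IH']]; last by split=> //; apply: le_trans IH (mono _).
have {}xy : 4 <= x%:Z * y%:Z by rewrite -PoszM lez_nat.
have x0 : 1 <= x%:Z by case: x xy {E0} => //; rewrite mul0r.
rewrite !chainE c_per -[chain c 0]/0 -[chain c 1]/1 E0 E1 mulr1 subr0.
have -> : x%:Z * (y%:Z * x%:Z - 1) - x%:Z = x%:Z * (x%:Z * y%:Z - 2) by ring.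
by rewrite [y%:Z * _]mulrC; move: (x%:Z * y%:Z) xy => p xy; split; nia.
Qed.

End ChainPositive.

Lemma eq_chain c c' : c =1 c' -> chain c =1 chain c'.
Proof.
move=> cc' m; suff [] : chain c m = chain c' m /\ chain c m.+1 = chain c' m.+1 by [].
by elim: m => // m [E E']; split; rewrite // !chainE E E' cc'.
Qed.

Section QuotientDegree.
Variables (n : nat) (R : idomainType) (F : fieldType).
Variable phi : {rmorphism {mpoly R[n]} -> F}.
Hypothesis phi_inj : forall p, phi p = 0 -> p = 0.
Variable w : 'X_{1..n} -> int.
Hypothesis wD : forall m1 m2, w (m1 + m2)%MM = w m1 + w m2.

Definition quot_deg (z : F) (d : int) : Prop :=
  exists A B (dA dB : int),
    [/\ has_top w A dA, has_top w B dB, z * phi B = phi A & d = dA - dB].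

Let phi_neq0 p d : has_top w p d -> phi p != 0.
Proof. by move=> /has_top_neq0; apply: contraNneq => /phi_inj ->. Qed.

Lemma quot_deg_uniq z d d' : quot_deg z d -> quot_deg z d' -> d = d'.
Proof.
move=> [A [B [dA [dB [tA tB E ->]]]]] [A' [B' [dA' [dB' [tA' tB' E' ->]]]]].
have AB : A * B' = A' * B.
  apply/eqP; rewrite -subr_eq0; apply/eqP/phi_inj; rewrite rmorphB !rmorphM /= -E -E'.
  by ring.
have := has_topM wD tA tB'; rewrite AB => /(has_top_uniq (has_topM wD tA' tB)) E1.
by move: E1; lia.
Qed.

Lemma quot_degM z z' d d' : quot_deg z d -> quot_deg z' d' -> quot_deg (z * z') (d + d').
Proof.
move=> [A [B [dA [dB [tA tB E ->]]]]] [A' [B' [dA' [dB' [tA' tB' E' ->]]]]].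
exists (A * A'), (B * B'), (dA + dA'), (dB + dB'); split; [exact: has_topM..| |ring].
by rewrite !rmorphM /= -E -E' mulrACA.
Qed.

Lemma quot_degV z d : quot_deg z d -> quot_deg z^-1 (- d).
Proof.
move=> [A [B [dA [dB [tA tB E ->]]]]]; exists B, A, dB, dA; split=> //; last by rewrite opprB.
have z0 : z != 0 by apply: contraNneq (phi_neq0 tA) => z0; rewrite -E z0 mul0r.
by rewrite -E mulKf.
Qed.

Let has_top1 : has_top w (1 : {mpoly R[n]}) 0.
Proof. exact: (has_topC wD (oner_neq0 R)). Qed.

Lemma quot_deg_poly A d : has_top w A d -> quot_deg (phi A) d.
Proof.
move=> tA; exists A, 1, d, 0; split=> //; rewrite ?rmorph1 ?mulr1 ?subr0 //.
Qed.

Lemma quot_degX z d k : quot_deg z d -> quot_deg (z ^+ k) (d *+ k).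
Proof.
move=> zd; elim: k => [|k IH]; last by rewrite exprS mulrS; exact: quot_degM.
by rewrite expr0 mulr0n -(rmorph1 phi); exact: quot_deg_poly.
Qed.

Lemma quot_deg_add1 z d : 0 < d -> quot_deg z d -> quot_deg (1 + z) d.
Proof.
move=> d0 [A [B [dA [dB [tA tB E Ed]]]]]; exists (A + B), B, dA, dB; split=> //.
  by apply: has_topD_lt tA tB _; move: d0; rewrite Ed; lia.
by rewrite mulrDl mul1r E rmorphD addrC.
Qed.

Variables (P : semifieldType) (e : P -> F) (a : nat -> nat) (z : nat -> P) (x : nat -> F).
Hypothesis H : exchange_sequence e a z x.
Hypothesis e_deg : forall p, quot_deg (e p) 0.
Hypotheses (x0 : quot_deg (x 0) 0) (x1 : quot_deg (x 1) 1).
Hypothesis a_gt0 : forall m, (0 < a m)%N.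

(** By induction [x j] has the chain as its degree: while the chain is positive, the term with
    [x m.+1] strictly dominates the 1 in the exchange relation. A positive degree separates [x j]
    from [x 0], of degree 0. *)
Lemma exchange_sequence_distinct M :
  (forall j, (0 < j <= M)%N -> 0 < chain (fun m => a m.+1) j) ->
  forall j, (0 < j <= M)%N -> x 0 != x j.
Proof.
move=> Mpos j jM; set v := chain _ in Mpos *.
suff dj : quot_deg (x j) (v j).
  apply/eqP => E; rewrite -E in dj; have := Mpos j jM.
  by rewrite -(quot_deg_uniq x0 dj) ltxx.
have {jM} jM : (j <= M)%N by case/andP: jM.
elim/ltn_ind: j jM => -[|[|m]] IH jM //.
have -> : x m.+2 = (1 + e (z m) * x m.+1 ^+ a m.+1) * (e (oplus 1%g (z m)))^-1 * (x m)^-1.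
  exact: eq_div_of_mul (exch_x H m) (exch_xE H m).
have -> : v m.+2 = (0 + v m.+1 *+ a m.+1) + - 0 + - v m.
  by rewrite add0r subr0 -mulr_natl natz.
apply: quot_degM; last by apply/quot_degV/IH; lia.
apply: quot_degM; last exact/quot_degV/e_deg.
have vm : 0 < v m.+1 by apply: Mpos; lia.
apply: quot_deg_add1; first by rewrite add0r pmulrn_lgt0.
apply: quot_degM => //; apply: quot_degX; apply: IH; lia.
Qed.

End QuotientDegree.

(** * Compatibility degrees *)

Lemma trop_initial_labeled_seed (B : 'M[int]_2) :
  skew_symmetrizable B -> is_labeled_seed (trop_initial_seed B).
Proof.
move=> sB; split=> //; set x := seed_x _.
have xE p : eval_at x p = p%:F.
  rewrite eval_atE [p in RHS]mpolyE rmorph_sum; apply: eq_bigr => m _.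
  rewrite -mul_mpolyC rmorphM mpolyXE_id rmorph_prod; congr (_ * _).
  by apply: eq_bigr => i _; rewrite ffunE rmorphXn.
split=> [p|z]; first by rewrite xE => /eqP; rewrite tofrac_eq0 => /eqP.
by have [p [q [q0 ->]]] := fraction_quotient z; exists p, q; rewrite !xE tofrac_eq0.
Qed.

Definition alt2 (c0 c1 m : nat) : nat := if odd m then c1 else c0.

Definition abs_entry (B : 'M[int]_2) (i : 'I_2) : nat := `|B i (rev_ord i)|%N.

Lemma line_a_alt (P : semifieldType) (K : fieldType) (Sigma : tree 2 -> seed P K 2) t k m :
  line_a Sigma t k m =
    alt2 (abs_entry (seed_B (Sigma t)) k) (abs_entry (seed_B (Sigma t)) (rev_ord k)) m.
Proof. by rewrite /line_a labS /lab /alt2 /abs_entry; case: (odd m). Qed.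

(** The index [r] is another position of the variable at [n], inside the range where the signs of
    the chains are controlled; it is the residue modulo the period in finite type. *)
Lemma f_entry_chain (B : 'M[int]_2) (t : tree 2) (k j : 'I_2) (m n r N : nat) :
  let c := alt2 (abs_entry B k) (abs_entry B (rev_ord k)) in
  let c' := alt2 (abs_entry B (rev_ord k)) (abs_entry B k) in
  skew_symmetrizable B ->
  (j = lab k m /\ n = m) \/ (j = lab k m.+1 /\ n = m.+1) ->
  (forall i, (i <= N)%N -> 0 <= chain c i.+1) ->
  (forall i, (i <= N)%N -> 0 <= chain c' i) ->
  (forall i, (i <= N)%N -> 0 < chain c i.+1 + chain c' i) ->
  (forall i, 0 < c i)%N \/ (N <= 1)%N -> (r <= N.+2)%N ->
  (forall Sigma, cluster_pattern (@trop_embed 2) Sigma ->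
     Sigma t = trop_initial_seed B -> line_x Sigma t k n = line_x Sigma t k r) ->
  (f_entry B t k j (walk t k m))%:Z = chain c r.-1 /\
  (f_entry B t (rev_ord k) j (walk t k m))%:Z = chain c' r.-2.
Proof.
move=> c c' sB jn cN c'N cc'N aN rN nr.
have key Sigma : cluster_pattern (@trop_embed 2) Sigma -> Sigma t = trop_initial_seed B ->
    exists f : {mpoly int[2]}, [/\ value_at_ones (seed_x (Sigma (walk t k m)) j) f%:F,
      (deg_in k f)%:Z = chain c r.-1 & (deg_in (rev_ord k) f)%:Z = chain c' r.-2].
  move=> HS St; have E := nr _ HS St.
  have aE : line_a Sigma t k =1 c by move=> i; rewrite line_a_alt St.
  have aE' : (fun i => line_a Sigma t k i.+1) =1 c'.
    by move=> i; rewrite line_a_alt St /c' /alt2 /=; case: (odd i).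
  have [||||f [vf dk dr]] := @principal_line B t k Sigma HS St N _ _ _ r _ rN.
  - by move=> i iN; rewrite (eq_chain aE) cN.
  - by move=> i iN; rewrite (eq_chain aE') c'N.
  - by move=> i iN; rewrite (eq_chain aE) (eq_chain aE') cc'N.
  - by case: aN => [a0|]; [left=> i; rewrite aE | right].
  exists f; split; last 2 first.
  - by rewrite dk (eq_chain aE).
  - by rewrite dr (eq_chain aE').
  by case: jn E => [] [-> ->] <- in vf *; [|rewrite (line_xS HS)].
have [Sig [HS St]] := cluster_pattern_exists (trop_frac_group_ring 2) t
  (trop_initial_labeled_seed sB).
have [f [vf _ _]] := key Sig HS St.
have spec : is_F_polynomial B t (walk t k m) j (F_polynomial B t (walk t k m) j).
  by apply: epsilon_spec; exists f, Sig.
(* The pattern witnessing the chosen polynomial need not be [Sig]. The computation is repeated in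
   it, and uniqueness of the value identifies the polynomial. *)
have [Sig' [HS' St' vF]] := spec; have [f' [vf' dk dr]] := key Sig' HS' St'.
have E : F_polynomial B t (walk t k m) j = f'.
  by apply/eqP; rewrite -tofrac_eq; apply/eqP; exact: value_at_ones_uniq vF vf'.
by rewrite /f_entry E.
Qed.

(** The types A1xA1, A2, B2 and G2, the last two in both orientations; the period is the Coxeter
    number plus 2. *)
Definition finite_type (c0 c1 p : nat) : bool :=
  (c0, c1, p) \in [:: (0, 0, 4); (1, 1, 5); (1, 2, 6); (2, 1, 6); (1, 3, 8); (3, 1, 8)]%N.

Lemma finite_typeP c0 c1 p : finite_type c0 c1 p ->
  [\/ [/\ c0 = 0, c1 = 0 & p = 4], [/\ c0 = 1, c1 = 1 & p = 5],
      [/\ c0 = 1, c1 = 2 & p = 6] \/ [/\ c0 = 2, c1 = 1 & p = 6] |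
      [/\ c0 = 1, c1 = 3 & p = 8] \/ [/\ c0 = 3, c1 = 1 & p = 8]]%N.
Proof.
rewrite /finite_type !inE !xpair_eqE -!andbA.
case/or4P => [|||/or3P[]] /and3P[/eqP -> /eqP -> /eqP ->].
- by constructor 1.
- by constructor 2.
- by constructor 3; left.
- by constructor 3; right.
- by constructor 4; left.
- by constructor 4; right.
Qed.

(** Skew-symmetrizability makes both off-diagonal entries vanish together, so a product below 4
    leaves only the tabulated pairs. *)
Lemma rank2_type (B : 'M[int]_2) k : skew_symmetrizable B ->
  let c0 := abs_entry B k in let c1 := abs_entry B (rev_ord k) in
  (exists p, finite_type c0 c1 p) \/ (4 <= c0 * c1)%N.
Proof.
move=> /skew2 [_ /(_ k) [s [s' [s0 s'0]]]]; rewrite /abs_entry rev_ordK.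
move: (B k _) (B _ k) => b b' E.
have [b0 b'0] : (b = 0 -> b' = 0) /\ (b' = 0 -> b = 0) by split; nia.
case: (leqP 4 (`|b| * `|b'|)) => [|lt4]; [by right | left].
have : (`|b| = 0 /\ `|b'| = 0 \/ 0 < `|b| /\ 0 < `|b'|)%N by lia.
move: (`|b|)%N (`|b'|)%N lt4 => c c' lt4 [[-> ->]|[c0 c'0]]; first by exists 4.
have [c4 c'4] : (c < 4 /\ c' < 4)%N by nia.
case: c c0 c4 lt4 => [|[|[|[|]]]] // _ _; case: c' c'0 c'4 => [|[|[|[|]]]] // _ _ _.
- by exists 5.
- by exists 6.
- by exists 8.
- by exists 6.
- by exists 8.
Qed.

Lemma exch_periodic (P : semifieldType) (F : fieldType) (e : P -> F) a z x c0 c1 p :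
  exchange_sequence e a z x -> a =1 alt2 c0 c1 -> finite_type c0 c1 p ->
  forall n, x n = x (n %% p)%N.
Proof.
move=> H aE fin n; have xp m : x (m + p)%N = x m.
  case: (finite_typeP fin) => [[E0 E1 ->]|[E0 E1 ->]|[] [E0 E1 ->]|[] [E0 E1 ->]].
  - by apply: exch_periodic_A1A1 H _ m => i; rewrite aE /alt2 E0 E1; case: (odd i).
  - by apply: exch_periodic_A2 H _ m => i; rewrite aE /alt2 E0 E1; case: (odd i).
  - by apply: exch_periodic_B2 H _ m => i; rewrite !aE /alt2 E0 E1 /=; case: (odd i); auto.
  - by apply: exch_periodic_B2 H _ m => i; rewrite !aE /alt2 E0 E1 /=; case: (odd i); auto.
  - by apply: exch_periodic_G2 H _ m => i; rewrite !aE /alt2 E0 E1 /=; case: (odd i); auto.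
  - by apply: exch_periodic_G2 H _ m => i; rewrite !aE /alt2 E0 E1 /=; case: (odd i); auto.
rewrite {1}(divn_eq n p); elim: (n %/ p)%N => [|q IH]; first by rewrite mul0n.
by rewrite mulSn -addnA addnC xp.
Qed.

Lemma finite_typeC c0 c1 p : finite_type c0 c1 p = finite_type c1 c0 p.
Proof.
rewrite /finite_type !inE !xpair_eqE.
by case: (c0 == _); case: (c0 == _); case: (c0 == _); case: (c0 == _);
   case: (c1 == _); case: (c1 == _); case: (c1 == _); case: (c1 == _);
   case: (p == _); case: (p == _); case: (p == _); case: (p == _).
Qed.

(** With one variable at position 0 and the other at [r], the outcomes are two steps ahead, two
    steps behind modulo the period, or an exceptional odd distance; each type is checked by
    inspection. *)
Lemma finite_chain_eq1 c0 c1 p r : finite_type c0 c1 p -> (r < p)%N ->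
  chain (alt2 c0 c1) r.-1 = 1 ->
  [\/ r = 2%N, r.+2 = p | [/\ odd r, ~~ odd p, c0 = 1%N & (2 <= c1)%N]].
Proof.
by case/finite_typeP => [[-> -> ->]|[-> -> ->]|[] [-> -> ->]|[] [-> -> ->]];
  move: r => [|[|[|[|[|[|[|[|r]]]]]]]] //= _ _;
  first [by constructor 1 | by constructor 2 | by constructor 3].
Qed.

Lemma alt2_per c0 c1 m : alt2 c0 c1 m.+2 = alt2 c0 c1 m.
Proof. by rewrite /alt2 /= negbK. Qed.

Lemma alt2_mul_ge4 c0 c1 : (4 <= c0 * c1)%N ->
  forall m, (4 <= alt2 c0 c1 m * alt2 c0 c1 m.+1)%N.
Proof. by move=> c4 m; rewrite /alt2 /=; case: (odd m); rewrite // mulnC. Qed.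

Lemma infinite_chain_eq1 c0 c1 r : (4 <= c0 * c1)%N -> chain (alt2 c0 c1) r = 1 ->
  r = 1%N \/ [/\ r = 2%N, c0 = 1%N & (2 <= c1)%N].
Proof.
move=> c4; case: r => [|[|[|r]]] //; first by left.
  rewrite chainE /= mulr1 subr0 => -[c01]; right; split=> //.
  by move: c4; rewrite [c0]c01 mul1n; apply: leq_trans.
by have := chain_ge2 (alt2_per c0 c1) (alt2_mul_ge4 c4) r; move=> /[swap] ->.
Qed.

Lemma imfset_ord2 (T : choiceType) (f : 'I_2 -> T) i :
  [fset f j | j in 'I_2]%fset = ([fset f (rev_ord i)] `|` [fset f i])%fset.
Proof.
apply/fsetP => z; rewrite in_fsetU !in_fset1; apply/imfsetP/orP.
  move=> [j _ ->]; case: (eqVneq j i) => [->|/ord2_case ->]; first by right.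
  by left.
by case=> /eqP ->; [exists (rev_ord i) | exists i].
Qed.

(** * Exchangeability and labels in an arbitrary rank 2 pattern *)

Section Rank2.
Variables (P : semifieldType) (K : fieldType) (e : P -> K).
Hypothesis He : frac_group_ring e.
Variable Sigma : tree 2 -> seed P K 2.
Hypothesis HSigma : cluster_pattern e Sigma.

Definition exchangeable (x x' : ratfun K 2) : Prop :=
  exists X : {fset ratfun K 2},
    [/\ forall z, z \in X -> is_cluster_variable Sigma z,
        is_cluster Sigma (X `|` [fset x])%fset &
        is_cluster Sigma (X `|` [fset x'])%fset].

Lemma exchangeable_sym x x' : exchangeable x x' -> exchangeable x' x.
Proof. by move=> [X [XP Xx Xx']]; exists X. Qed.

Let e1 := frac_group_ring1 He.
Let eM := frac_group_ringM He.
Let exch t k := line_exchange e1 eM HSigma t k.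

Let skew s : skew_symmetrizable (seed_B (Sigma s)).
Proof. by case: HSigma => /(_ s)[]. Qed.

Lemma cluster2 s i : cluster Sigma s =
  ([fset seed_x (Sigma s) (rev_ord i)] `|` [fset seed_x (Sigma s) i])%fset.
Proof. exact: imfset_ord2. Qed.

Lemma line_exchangeable t k m :
  exchangeable (line_x Sigma t k m) (line_x Sigma t k m.+2).
Proof.
exists [fset line_x Sigma t k m.+1]%fset; split.
- by move=> z; rewrite in_fset1 => /eqP ->; exists (walk t k m.+1), (lab k m.+1).
- exists (walk t k m); rewrite (cluster2 _ (lab k m)) -labS (line_xS HSigma); by [].
- exists (walk t k m.+1); rewrite (cluster2 _ (lab k m.+2)) (line_xS HSigma).
  by rewrite labS rev_ordK.
Qed.

Lemma line_surj t t' j : exists k m n, [/\ t' = walk t k m,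
  seed_x (Sigma t') j = line_x Sigma t k n, j = lab k n &
  (j = lab k m /\ n = m) \/ (j = lab k m.+1 /\ n = m.+1)].
Proof.
have [k [m ->]] := walk_surj t t'; exists k, m.
case: (eqVneq j (lab k m)) => [->|/ord2_case ->]; first by exists m; split; auto.
by exists m.+1; rewrite -labS (line_xS HSigma); split; auto.
Qed.

Lemma labs_parity (k : 'I_2) m n : (lab k m == lab k n) = (odd m == odd n).
Proof.
rewrite /lab; case: (odd m); case: (odd n); rewrite ?eqxx //.
  exact: negbTE (rev_ord2_neq k).
by rewrite eq_sym; exact: negbTE (rev_ord2_neq k).
Qed.

Let mod_odd n p : ~~ odd p -> odd (n %% p) = odd n.
Proof. by move=> pev; rewrite [in RHS](divn_eq n p) oddD oddM (negbTE pev) andbF. Qed.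

(** The walk starts at [t], so the first variable is at position 0 or 1 according to its label. The
    two positions use chains with the exponents swapped and the index shifted by one. *)
Lemma compat_one t t' i j : f_entry (seed_B (Sigma t)) t i j t' = 1%N ->
  exchangeable (seed_x (Sigma t) i) (seed_x (Sigma t') j) \/
  [/\ i != j, abs_entry (seed_B (Sigma t)) i = 1%N &
      (2 <= abs_entry (seed_B (Sigma t)) (rev_ord i))%N].
Proof.
have [k [m [n [-> -> jn jmn]]]] := line_surj t t' j => f1.
set B := seed_B _ in f1 *; set x := line_x Sigma t k.
pose c0 := abs_entry B k; pose c1 := abs_entry B (rev_ord k).
have xk : seed_x (Sigma t) k = x 0 by [].
have xr : seed_x (Sigma t) (rev_ord k) = x 1 by exact: (line_xS HSigma t k 0).
have swap r s : x n = x r -> x r.+2 = x s -> exchangeable (x s) (x n).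
  by move=> -> <-; apply/exchangeable_sym/line_exchangeable.
have direct r : x n = x r.+2 -> exchangeable (x r) (x n).
  by move=> ->; exact: line_exchangeable.
have [[p fin]|inf] : (exists p, finite_type c0 c1 p) \/ (4 <= c0 * c1)%N :=
  rank2_type k (skew t).
  have xp r : x r = x (r %% p)%N.
    by apply: exch_periodic (exch t k) _ fin _ => s; exact: line_a_alt.
  (* In every finite type the chains are nonnegative up to index [p - 2]; the bound [p - 3] then
     covers all residues, which are at most [p - 1]. *)
  have [||||||fk fr] := @f_entry_chain B t k j m n (n %% p)%N (p - 3)%N (skew t) jmn.
  - rewrite -/c0 -/c1 => s; case: (finite_typeP fin) => [[-> -> ->]|[-> -> ->]|[]
        [-> -> ->]|[] [-> -> ->]];
      by move: s => [|[|[|[|[|[|]]]]]].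
  - rewrite -/c0 -/c1 => s; case: (finite_typeP fin) => [[-> -> ->]|[-> -> ->]|[]
        [-> -> ->]|[] [-> -> ->]];
      by move: s => [|[|[|[|[|[|]]]]]].
  - rewrite -/c0 -/c1 => s; case: (finite_typeP fin) => [[-> -> ->]|[-> -> ->]|[]
        [-> -> ->]|[] [-> -> ->]];
      by move: s => [|[|[|[|[|[|]]]]]].
  - rewrite -/c0 -/c1; case: (finite_typeP fin) => [[-> -> ->]|[-> -> ->]|[]
        [-> -> ->]|[] [-> -> ->]];
      by [right | left=> s; rewrite /alt2; case: (odd s)].
  - have p3 : (3 <= p)%N.
      by case: (finite_typeP fin) => [[_ _ ->]|[_ _ ->]|[] [_ _ ->]|[] [_ _ ->]].
    have := @ltn_pmod n p; lia.
  - move=> S HS St; apply: exch_periodic (line_exchange _ _ HS t k) _ fin _.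
    + exact: frac_group_ring1 (trop_frac_group_ring 2).
    + exact: frac_group_ringM (trop_frac_group_ring 2).
    + by move=> s; rewrite line_a_alt St.
  rewrite -/c0 -/c1 in fk fr.
  have p4 : (4 <= p)%N.
    by case: (finite_typeP fin) => [[_ _ ->]|[_ _ ->]|[] [_ _ ->]|[] [_ _ ->]].
  have rp : (n %% p < p)%N by rewrite ltn_pmod //; lia.
  have xp0 : x p = x 0 by rewrite xp modnn.
  have p1 : (p.+1 %% p = 1)%N by rewrite -addn1 modnDl modn_small //; lia.
  have xp1 : x p.+1 = x 1 by rewrite xp p1.
  case: (eqVneq i k) f1 => [->|/ord2_case ->] f1.
    rewrite f1 in fk; case: (finite_chain_eq1 fin rp (esym fk)) => [r2|rp2|[ro po E0 E1]].
    - by left; rewrite xk; apply: direct; rewrite xp r2.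
    - by left; rewrite xk; apply: (swap (n %% p)%N); [exact: xp | rewrite rp2; exact: xp0].
    right; split=> //; rewrite jn -[k in k != _]/(lab k 0) labs_parity.
    by rewrite -(mod_odd n po) ro.
  (* The residue is not 0, for there the truncated index would give degree 0 instead of 1. *)
  have sr : ((n %% p).-1.+1 = n %% p)%N.
    by case: (n %% p)%N fr => // fr; rewrite f1 in fr.
  rewrite f1 in fr; rewrite finite_typeC in fin.
  have rp' : ((n %% p)%N.-1 < p)%N by lia.
  case: (finite_chain_eq1 fin rp' (esym fr)) => [r2|rp2|[ro po E0 E1]].
  - by left; rewrite xr; apply: direct; rewrite xp -sr r2.
  - by left; rewrite xr; apply: (swap (n %% p)%N); [exact: xp | rewrite -sr rp2; exact: xp1].
  right; split=> //; last by rewrite rev_ordK.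
  rewrite jn -[rev_ord k]/(lab k 1) labs_parity.
  by rewrite -(mod_odd n po) -sr /= ro.
have [||||||fk fr] := @f_entry_chain B t k j m n n n (skew t) jmn; rewrite -/c0 -/c1.
- by move=> s _; apply: chain_ge0; [exact: alt2_per | exact: alt2_mul_ge4].
- by move=> s _; apply: chain_ge0; [exact: alt2_per | apply: alt2_mul_ge4; rewrite mulnC].
- move=> s _; apply: ltr_wpDr; last by apply: chain_gt0; [exact: alt2_per | exact: alt2_mul_ge4].
  by apply: chain_ge0; [exact: alt2_per | apply: alt2_mul_ge4; rewrite mulnC].
- by left=> s; have := alt2_mul_ge4 inf s; case: (alt2 _ _ s).
- by lia.
- by [].
rewrite -/c0 -/c1 in fk fr.
case: (eqVneq i k) f1 => [->|/ord2_case ->] f1.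
  rewrite f1 in fk; case: (infinite_chain_eq1 inf (esym fk)) => [r1|[r2 E0 E1]].
    by left; rewrite xk; apply: direct; congr x; lia.
  right; split=> //; rewrite jn -[k in k != _]/(lab k 0) labs_parity.
  by have -> : n = 3%N by lia.
rewrite f1 in fr; rewrite mulnC in inf.
case: (infinite_chain_eq1 inf (esym fr)) => [r1|[r2 E0 E1]].
  by left; rewrite xr; apply: direct; congr x; lia.
right; split=> //; last by rewrite rev_ordK.
rewrite jn -[rev_ord k]/(lab k 1) labs_parity.
by have -> : n = 4%N by lia.
Qed.


Lemma abs_entry_const s s' i :
  abs_entry (seed_B (Sigma s)) i = abs_entry (seed_B (Sigma s')) i.
Proof.
apply: (@tree_ind 2 (fun s' => _ = abs_entry (seed_B (Sigma s')) i) _ s) => // {}s' k ->.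
have [_ ->] := HSigma; rewrite /= mut_B2; last exact: skew.
by rewrite /abs_entry mxE abszN.
Qed.

(** If the walk from [t] begins with the other label, its start moves across that edge, which leaves
    the variable labeled [i] unchanged. *)
Lemma walk_start t t' i : exists s m,
  seed_x (Sigma s) i = seed_x (Sigma t) i /\ t' = walk s i m.
Proof.
have [k [m ->]] := walk_surj t t'; case: (eqVneq i k) => [->|/ord2_case ->].
  by exists t, m.
case: m => [|m]; first by exists t, 0%N.
exists (neighbor k t), m; split.
  exact/esym/(line_xS HSigma t k 0).
elim: m => // m IH; rewrite -[LHS]/(neighbor (lab k m.+1) (walk t k m.+1)) IH.
by congr (neighbor _ _); rewrite /lab /= rev_ordK; case: (odd m).
Qed.

Lemma seed_x_distinct s i : seed_x (Sigma s) i != seed_x (Sigma s) (rev_ord i).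
Proof.
case: HSigma => /(_ s) [[fx _] _] _; apply/eqP => E.
have /fx : eval_at (seed_x (Sigma s)) ('X_i - 'X_(rev_ord i)) = 0.
  by rewrite rmorphB /= !eval_at_var E subrr.
move/(congr1 (mcoeff U_(i)%MM)); rewrite mcoeffB !mcoeffXU mcoeff0 eqxx.
by rewrite (negbTE (rev_ord2_neq i)) subr0; apply/eqP/oner_neq0.
Qed.

(** On a walk starting with label [i], the label [j] sits at odd positions. Their variables are
    separated from [x 0] by the degree in [x 1], except at the last position of a period, which
    shares a cluster with the next copy of [x 0]. *)
Lemma labels_distinct t t' i j : i != j ->
  (2 <= abs_entry (seed_B (Sigma t)) i * abs_entry (seed_B (Sigma t)) (rev_ord i))%N ->
  seed_x (Sigma t) i != seed_x (Sigma t') j.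
Proof.
move=> ij; have [s [m [<- ->]]] := walk_start t t' i.
rewrite !(abs_entry_const t s); set c0 := abs_entry _ i; set c1 := abs_entry _ _ => c2.
set x := line_x Sigma s i.
have [n [-> nodd]] : exists n, seed_x (Sigma (walk s i m)) j = x n /\ odd n.
  have sub n : j = lab i n -> odd n.
    by move=> jn; move: ij; rewrite jn -{1}[i]/(lab i 0) labs_parity; case: (odd n).
  case: (eqVneq j (lab i m)) => [jm|/ord2_case].
    by exists m; rewrite {1}jm; split; auto.
  by rewrite -labS => jm; exists m.+1; rewrite {1}jm (line_xS HSigma); split; auto.
rewrite -[seed_x _ i]/(x 0).
have xE := exch s i; have aE : line_a Sigma s i =1 alt2 c0 c1 by move=> r; exact: line_a_alt.
have aE' : (fun r => line_a Sigma s i r.+1) =1 alt2 c1 c0.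
  by move=> r; rewrite line_a_alt /alt2 /=; case: (odd r).
have a0 r : (0 < line_a Sigma s i r)%N.
  by rewrite aE /alt2; case: (odd r); rewrite lt0n; apply: contraTneq c2 => ->; rewrite ?muln0.
have xS r : x r != x r.+1.
  have := seed_x_distinct (walk s i r) (lab i r).
  by rewrite -labS (line_xS HSigma); exact.
have dist M r : (forall q, (0 < q <= M)%N -> 0 < chain (alt2 c1 c0) q) ->
    (0 < r <= M)%N -> x 0 != x r.
  move=> Mpos; case: HSigma => /(_ s) [[fx _] _] _.
  pose w (p : 'X_{1..2}) : int := (p (rev_ord i))%:Z.
  have wD p p' : w (p + p')%MM = w p + w p' by rewrite /w mnmDE PoszD.
  have qp A d := @quot_deg_poly _ _ _ (eval_at (seed_x (Sigma s))) w wD A d.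
  have ed p : quot_deg (eval_at (seed_x (Sigma s))) w (ratfunC 2 (e p)) 0.
    rewrite -(eval_atC (seed_x (Sigma s))); apply: qp.
    apply: (has_topC wD); apply/eqP => ep.
    have := eM p p^-1%g; rewrite mulgV e1 ep mul0r; exact/eqP/oner_neq0.
  have vd k d : w U_(k)%MM = d -> quot_deg (eval_at (seed_x (Sigma s))) w (seed_x (Sigma s) k) d.
    move=> wk; rewrite -[X in quot_deg _ _ X](eval_at_var (seed_x (Sigma s))).
    by apply: qp; rewrite -wk; exact: has_top_mon.
  have d0 : quot_deg (eval_at (seed_x (Sigma s))) w (x 0) 0.
    by apply: vd; rewrite /w mnm1E eq_sym (negbTE (rev_ord2_neq i)).
  have d1 : quot_deg (eval_at (seed_x (Sigma s))) w (x 1) 1.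
    by rewrite -[x 1](line_xS HSigma s i 0); apply: vd; rewrite /w mnm1E eqxx.
  apply: (exchange_sequence_distinct fx wD xE ed d0 d1 a0).
  by move=> q qM; rewrite (eq_chain aE') Mpos.
have [[p fin]|inf] : (exists p, finite_type c0 c1 p) \/ (4 <= c0 * c1)%N :=
  rank2_type i (skew s).
  have xp r : x r = x (r %% p)%N by apply: exch_periodic xE aE fin _.
  have lastE : x p = x 0 by rewrite xp modnn.
  have last_neq q : q.+1 = p -> x 0 != x q by move=> qp; rewrite -lastE -qp eq_sym.
  (* The bound on the product excludes A2, the only type of odd period, so parity survives reduction
     modulo [p]. *)
  have podd : ~~ odd p.
    by case: (finite_typeP fin) c2 => [[_ _ ->]|[-> -> _]|[] [_ _ ->]|[] [_ _ ->]].
  have : odd (n %% p) by rewrite mod_odd.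
  have : (n %% p < p)%N.
    by apply: ltn_pmod; case: (finite_typeP fin) => [[_ _ ->]|[_ _ ->]|[] [_ _ ->]|[] [_ _ ->]].
  rewrite (xp n); move: (n %% p)%N => r rp ro.
  case: (eqVneq r.+1 p) => [/last_neq //|rp1].
  have rp2 : r.+2 != p by apply: contraNneq podd => <- /=; rewrite ro.
  (* An odd residue other than [p - 1] is at most [p - 3], and up to there the chain is positive. *)
  apply: (dist (p - 3)%N); last by case: r rp ro rp1 rp2 => //= r; lia.
  move=> q; case: (finite_typeP fin) c2 =>
    [[-> -> ->]|[-> -> ->]|[] [-> -> ->]|[] [-> -> ->]] //= _;
    by move: q => [|[|[|[|[|[|[|q]]]]]]].
apply: (dist n); last by rewrite leqnn andbT; case: n nodd.
by case=> // q _; apply: chain_gt0; [exact: alt2_per | apply: alt2_mul_ge4; rewrite mulnC].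
Qed.

End Rank2.

Theorem theorem4p25 (P : semifieldType) (K : fieldType) (e : P -> K)
    (He : frac_group_ring e)
    (Sigma : tree 2 -> seed P K 2) (HSigma : cluster_pattern e Sigma)
    (x x' : ratfun K 2)
    (Hx : is_cluster_variable Sigma x) (Hx' : is_cluster_variable Sigma x') :
  compat_degree Sigma x x' = 1%N -> compat_degree Sigma x' x = 1%N ->
  exists X : {fset ratfun K 2},
    [/\ forall z, z \in X -> is_cluster_variable Sigma z,
        is_cluster Sigma (X `|` [fset x])%fset &
        is_cluster Sigma (X `|` [fset x'])%fset].
Proof.
have compatP z z' : is_cluster_variable Sigma z -> is_cluster_variable Sigma z' ->
    compat_degree Sigma z z' = 1%N -> exists (i j : 'I_2) (t t' : tree 2),
    [/\ z = seed_x (Sigma t) i, z' = seed_x (Sigma t') j &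
        f_entry (seed_B (Sigma t)) t i j t' = 1%N].
  move=> [t [i zE]] [t' [j z'E]] c1.
  (* Both arguments being cluster variables, the chosen degree is realized by some labels and
     vertices. *)
  have := @epsilon_spec nat (inhabits 0%N) (fun d => exists (i j : 'I_2) (t t' : tree 2),
    [/\ z = seed_x (Sigma t) i, z' = seed_x (Sigma t') j &
        d = f_entry (seed_B (Sigma t)) t i j t']).
  rewrite -/(compat_degree Sigma z z') c1 => -[|i1 [j1 [t1 [t1' [E E' F]]]]].
    by exists (f_entry (seed_B (Sigma t)) t i j t'), i, j, t, t'; split.
  by exists i1, j1, t1, t1'; split.
move=> /(compatP _ _ Hx Hx') [i [j [t [t' [xE x'E f1]]]]].
move=> /(compatP _ _ Hx' Hx) [j2 [i2 [s' [s [x'E2 xE2 f2]]]]].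
case: (compat_one He HSigma f1) => [|[ij ai ari]]; first by rewrite -xE -x'E.
case: (compat_one He HSigma f2) => [|[ji2 aj arj]].
  by rewrite -xE2 -x'E2; exact: exchangeable_sym.
(* The exponent at [i] is 1 and the one opposite to [j2] is at least 2; exponents do not depend on
   the vertex, so [j2] cannot be the other label. *)
have j2i : j2 = i.
  apply/eqP; apply: contraTT arj => /ord2_case j2r.
  by rewrite j2r rev_ordK (abs_entry_const HSigma s' t) ai.
(* Now [x] carries the label [i] at [t] and the different label [i2] at [s], although the product of
   the exponents is at least 2. *)
have := @labels_distinct _ _ _ He _ HSigma t s i i2.
by rewrite -xE -xE2 eqxx ai mul1n -j2i => /(_ ji2); rewrite j2i => /(_ ari).
Qed.
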